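(* Let $\Omega\subset\mathbb{R}^m$ be open and bounded, and let $\mathcal{M}\in C^0(\overline\Omega,S_m^+)$. (a) If $m\le 3$, then the FM-LBR family of meshes $(\mathcal{T}(\mathcal{M}(x)))_{x\in\Omega}$ is admissible; moreover, for $m\in\{2,3\}$, the (Boundedness) property holds with the constant $R=C_m\,\kappa(\mathcal{M})$, where $C_2=2$ and $C_3=4$. (b) More generally, if $m\le 4$, then any family of meshes $(\mathcal{T}(x))_{x\in\Omega}$ such that $\mathcal{T}(x)$ is $\mathcal{M}(x)$-acute for all $x\in\Omega$ satisfies the (Stability) property, for some constant $r>0$.
   Context: $S_m^+$ is the set of $m\times m$ symmetric positive definite real matrices. $\|\cdot\|$ is the Euclidean norm (operator norm for matrices). For $M\in S_m^+$, $\kappa(M):=\sqrt{\|M\|\,\|M^{-1}\|}$, and $\kappa(\mathcal{M}):=\max_{z\in\overline\Omega}\kappa(\mathcal{M}(z))$. A mesh in $\mathbb{R}^m$ is a finite collection of $m$-dimensional non-flat simplices which is conforming: the intersection $T\cap T'$ of any two of its simplices is the convex hull of their common vertices. A basis of $\mathbb{Z}^m$ is an $m$-tuple of elements of $\mathbb{Z}^m$ with determinant $\pm1$. A superbase of $\mathbb{Z}^m$ is an $(m+1)$-tuple $(e_0,\dots,e_m)$ with $e_0+\dots+e_m=0$ and $(e_1,\dots,e_m)$ a basis of $\mathbb{Z}^m$; it is $M$-obtuse iff $\langle e_i,Me_j\rangle\le0$ for all $0\le i<j\le m$. $M$-acute mesh ($M\in S_m^+$): a mesh in $\mathbb{R}^m$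 covering a neighborhood of the origin and such that the vertices $v_0,\dots,v_m$ of any of its simplices (suitably ordered) satisfy (i) $v_0=0$, (ii) $(v_1,\dots,v_m)$ is a basis of $\mathbb{Z}^m$, (iii) $\langle v_i,Mv_j\rangle\ge0$ for all $1\le i<j\le m$. FM-LBR mesh $\mathcal{T}(M)$: for $m\le3$ every $M\in S_m^+$ admits an $M$-obtuse superbase $(e_0,\dots,e_m)$ of $\mathbb{Z}^m$ (known fact). One such superbase is chosen (arbitrarily) for each $M$, and $\mathcal{T}(M)$ is the collection of the simplices with vertices $\left(\sum_{i=0}^{k-1}b_i\right)_{k=0}^m$ associated to all $(m+1)!$ permutations $(b_i)_{i=0}^m$ of $(e_i)_{i=0}^m$; it is an $M$-acute mesh. Admissibility: a family of meshes $(\mathcal{T}(x))_{x\in\Omega}$ in $\mathbb{R}^m$ is admissible iff there exist two constants $0<r$ and $R<\infty$ such that for each $x\in\Omega$: - the mesh $\mathcal{T}(x)$ covers a neighborhood of $0$, and its vertices belong to $\mathbb{Z}^m$; - (Boundedness) the vertices $e$ of $\mathcal{T}(x)$ satisfy $\|e\|\le R$; - (Stability) there exists a basis $\mathcal{B}(x)$ of $\mathbb{Z}^m$ whose elements, and their opposites, are vertices of $\mathcal{T}(y)$ for all $y\in\Omega$ such that $\|x-y\|<r$. *)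

(* Defs.v *)
From HB Require Import structures.
From mathcomp Require Import all_boot all_order all_fingroup all_algebra.
From mathcomp Require Import finmap.
From mathcomp Require Import all_classical all_reals all_analysis.

Set Implicit Arguments.
Unset Strict Implicit.
Unset Printing Implicit Defensive.

Import Order.TTheory GRing.Theory Num.Theory.
Import numFieldNormedType.Exports.

Local Open Scope classical_set_scope.
Local Open Scope ring_scope.

(* Points of R^m are column vectors.  The topology, [open], [closure], [nbhs]
   and [bounded_set] are the ones the library derives from the sup norm; since
   this norm is equivalent to the Euclidean one they are the usual notions.
   The library norm [`|x|] itself is the sup norm, hence [enorm] below. *)

Section Euclidean.
Context {R : realType} {m : nat}.

Definition dotp (u v : 'cV[R]_m) : R := (u^T *m v) 0 0.

Definition enorm (u : 'cV[R]_m) : R := Num.sqrt (dotp u u).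

Definition opnorm (A : 'M[R]_m) : R :=
  sup [set enorm (A *m x) | x in [set x : 'cV[R]_m | enorm x <= 1]].

Definition is_spd (M : 'M[R]_m) : Prop :=
  M^T = M /\ (forall u : 'cV[R]_m, u != 0 -> 0 < dotp u (M *m u)).

Definition kappa (M : 'M[R]_m) : R :=
  Num.sqrt (opnorm M * opnorm (invmx M)).

(* For continuous [M : closure Omega -> S_m^+], with [Omega] bounded and
   nonempty, the supremum is attained. *)
Definition kappa_max (Omega : set 'cV[R]_m) (M : 'cV[R]_m -> 'M[R]_m) : R :=
  sup [set kappa (M z) | z in closure Omega].

End Euclidean.

Section Meshes.
Context {R : realType} {m : nat}.

(* A simplex is represented by its set of vertices; the corresponding subset
   of R^m is [hull S]. *)
Implicit Types (S : {fset 'cV[R]_m}) (T : {fset {fset 'cV[R]_m}}).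

Definition hull S : set 'cV[R]_m :=
  [set p | exists w : 'cV[R]_m -> R,
     [/\ forall v, v \in S -> 0 <= w v,
         \sum_(v <- S) w v = 1 &
         p = \sum_(v <- S) w v *: v]].

Definition is_simplex S : Prop :=
  exists2 v : 'I_m.+1 -> 'cV[R]_m,
    S = [fset v i | i in 'I_m.+1]%fset &
    \det (\matrix_(i < m, j < m) (v (lift ord0 j) - v ord0) i 0) != 0.

Definition is_mesh T : Prop :=
  (forall S, S \in T -> is_simplex S) /\
  (forall S S', S \in T -> S' \in T -> hull S `&` hull S' = hull (S `&` S')%fset).

Definition is_vertex T (v : 'cV[R]_m) : Prop := exists2 S, S \in T & v \in S.

Definition covers_nbhs0 T : Prop :=
  nbhs (0 : 'cV[R]_m) (\bigcup_(S in [set` T]) hull S).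

End Meshes.

Section Lattice.
Context {R : realType} {m : nat}.

Definition zvec (z : 'cV[int]_m) : 'cV[R]_m := map_mx intr z.

(* Tuples of elements of Z^m are the columns of an integer matrix. *)
Definition is_zbasis (B : 'M[int]_m) : Prop := \det B = 1 \/ \det B = -1.

Definition is_superbase (E : 'M[int]_(m, m.+1)) : Prop :=
  \sum_(i < m.+1) col i E = 0 /\ is_zbasis (col' ord0 E).

Definition is_obtuse (M : 'M[R]_m) (E : 'M[int]_(m, m.+1)) : Prop :=
  forall i j : 'I_m.+1, (i < j)%N ->
    dotp (zvec (col i E)) (M *m zvec (col j E)) <= 0.

Definition is_acute_mesh (M : 'M[R]_m) (T : {fset {fset 'cV[R]_m}}) : Prop :=
  [/\ is_mesh T,
      covers_nbhs0 T &
      forall S, S \in T -> exists B : 'M[int]_m,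
        [/\ is_zbasis B,
            S = (0%R |` [fset zvec (col j B) | j in 'I_m])%fset &
            forall i j : 'I_m, (i < j)%N ->
              0 <= dotp (zvec (col i B)) (M *m zvec (col j B))]].

Definition fmlbr_vertex (E : 'M[int]_(m, m.+1)) (s : 'S_m.+1) (k : 'I_m.+1) :
    'cV[R]_m :=
  zvec (\sum_(i < m.+1 | (i < k)%N) col (s i) E).

Definition fmlbr_simplex (E : 'M[int]_(m, m.+1)) (s : 'S_m.+1) :
    {fset 'cV[R]_m} :=
  [fset fmlbr_vertex E s k | k in 'I_m.+1]%fset.

Definition fmlbr_mesh (E : 'M[int]_(m, m.+1)) : {fset {fset 'cV[R]_m}} :=
  [fset fmlbr_simplex E s | s in 'S_m.+1]%fset.

End Lattice.

Section Admissibility.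
Context {R : realType} {m : nat}.
Implicit Types (Omega : set 'cV[R]_m) (T : 'cV[R]_m -> {fset {fset 'cV[R]_m}}).

Definition boundedness Omega T (Rb : R) : Prop :=
  forall x, Omega x -> forall e, is_vertex (T x) e -> enorm e <= Rb.

Definition stability Omega T (r : R) : Prop :=
  forall x, Omega x -> exists2 B : 'M[int]_m, is_zbasis B &
    forall y, Omega y -> enorm (x - y) < r ->
      forall j, is_vertex (T y) (zvec (col j B)) /\
                is_vertex (T y) (- zvec (col j B)).

Definition admissible Omega T : Prop :=
  (forall x, Omega x -> is_mesh (T x)) /\
  exists r Rb : R,
    [/\ 0 < r,
        forall x, Omega x -> covers_nbhs0 (T x) /\
          (forall v, is_vertex (T x) v -> exists z : 'cV[int]_m, v = zvec z),
        boundedness Omega T Rb &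
        stability Omega T r].

End Admissibility.

(* Main.v *)
Require Import Defs.
From HB Require Import structures.
From mathcomp Require Import all_boot all_order all_fingroup all_algebra.
From mathcomp Require Import finmap.
From mathcomp Require Import all_classical all_reals all_analysis.
From mathcomp Require Import ring lra zify.

Set Implicit Arguments.
Unset Strict Implicit.
Unset Printing Implicit Defensive.

Import Order.TTheory GRing.Theory Num.Theory.
Import numFieldNormedType.Exports.

Local Open Scope classical_set_scope.
Local Open Scope ring_scope.

(** Both parts of the statement come down to lattice geometry.

    Stability.  For a positive definite [A] in dimension at most four there is
    a basis of the lattice such that every lattice vector with a nonzero
    coordinate along a basis vector is at least as long, for [A], as this basis
    vector ([exists_reduced_zbasis]).  It is obtained by minimizing the sum of
    the squared [A]-lengths of the columns over nonsingular integer matrices,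
    and then the absolute value of the determinant.  If the determinant were
    not a unit, rounding the coordinates of a lattice vector outside the span
    of the columns would produce a substitute for one of the columns, no longer
    than it because the dimension is at most four, that lowers the determinant
    ([energy_minimal_descent]).

    Take such a basis for [M x].  An acute mesh for [M y] covers a neighborhood
    of the origin, so a basis vector [e] is a nonnegative integer combination
    of the vertices of one of its simplices.  Some vertex [v] in this
    combination has a nonzero coordinate along [e], hence is not shorter than
    [e] for [M x].  If [e] is not [v] then, by acuteness, the square of the
    [M y]-length of [e] exceeds that of [v] by at least the square of the
    length of the nonzero lattice vector [e - v], which is a contradiction as
    soon as [M y] is close to [M x] ([acute_mesh_vertex]).  The same applies to
    [- e].  Compactness of the closure of [Omega] provides uniform coercivity,
    upper bounds and continuity, hence a radius that does not depend on [x]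
    ([acute_family_stability]).

    The mesh of a superbase.  Write points as [\sum_j x j *: e j], where [x] is
    unique up to an additive constant.  The simplex attached to an ordering of
    the superbase consists of the points whose coordinates decrease along this
    ordering with total variation at most one.  This shows that the mesh is
    conforming ([fmlbr_conforming]) and covers a neighborhood of the origin
    ([fmlbr_covers]); obtuseness of the superbase gives acuteness of the mesh
    ([fmlbr_acute_mesh]), so that stability follows from the general result.

    Boundedness.  By Selling's formula a vertex of the mesh of an obtuse
    superbase is a shortest element of its class modulo 2
    ([partial_sum_shortest_mod2]).  Each class contains a vector with all
    coordinates 0 or 1, of squared Euclidean length at most [m].  Comparing the
    two norms bounds the vertices by [sqrt m * kappa] ([fmlbr_vertex_enorm]),
    and [sqrt 2 <= 2], [sqrt 3 <= 4]. *)

(** * Quadratic forms on Euclidean space *)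

Section QuadraticForms.
Context {R : realType} {m : nat}.
Implicit Types (u v w : 'cV[R]_m) (A : 'M[R]_m).

Lemma dotpE u v : dotp u v = \sum_i u i 0 * v i 0.
Proof. by rewrite /dotp mxE; apply: eq_bigr => i _; rewrite mxE. Qed.

Lemma dotpC u v : dotp u v = dotp v u.
Proof. by rewrite !dotpE; apply: eq_bigr => i _; rewrite mulrC. Qed.

Lemma dotpDl u v w : dotp (u + v) w = dotp u w + dotp v w.
Proof. by rewrite /dotp linearD mulmxDl mxE. Qed.

Lemma dotpZl a u v : dotp (a *: u) v = a * dotp u v.
Proof. by rewrite /dotp linearZ -scalemxAl mxE. Qed.

Lemma dotpDr u v w : dotp u (v + w) = dotp u v + dotp u w.
Proof. by rewrite dotpC dotpDl !(dotpC u). Qed.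

Lemma dotpZr a u v : dotp u (a *: v) = a * dotp u v.
Proof. by rewrite dotpC dotpZl dotpC. Qed.

Lemma dotpNr u v : dotp u (- v) = - dotp u v.
Proof. by rewrite -scaleN1r dotpZr mulN1r. Qed.

Lemma dotpNl u v : dotp (- u) v = - dotp u v.
Proof. by rewrite dotpC dotpNr dotpC. Qed.

Lemma dotp0r u : dotp u 0 = 0.
Proof. by rewrite /dotp mulmx0 mxE. Qed.

Lemma dotp0l u : dotp 0 u = 0.
Proof. by rewrite dotpC dotp0r. Qed.

Lemma dotp_sumr (I : Type) (r : seq I) (P : pred I) (F : I -> 'cV[R]_m) u :
  dotp u (\sum_(i <- r | P i) F i) = \sum_(i <- r | P i) dotp u (F i).
Proof.
by elim/big_rec2: _ => [|i x y _ <-]; rewrite ?dotp0r ?dotpDr.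
Qed.

Lemma dotp_suml (I : Type) (r : seq I) (P : pred I) (F : I -> 'cV[R]_m) u :
  dotp (\sum_(i <- r | P i) F i) u = \sum_(i <- r | P i) dotp (F i) u.
Proof. by rewrite dotpC dotp_sumr; apply: eq_bigr => i _; rewrite dotpC. Qed.

Lemma dotp_mulmxl A u v : dotp (A *m u) v = dotp u (A^T *m v).
Proof. by rewrite /dotp trmx_mul mulmxA. Qed.

Lemma dotp_ge0 u : 0 <= dotp u u.
Proof. by rewrite dotpE sumr_ge0 // => i _; rewrite -expr2 sqr_ge0. Qed.

Lemma sqr_coord_le_dotp u i : u i 0 ^+ 2 <= dotp u u.
Proof.
rewrite dotpE (bigD1 i) //= -expr2 lerDl sumr_ge0 // => j _.
by rewrite -expr2 sqr_ge0.
Qed.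

Lemma dotp_eq0 u : (dotp u u == 0) = (u == 0).
Proof.
apply/eqP/eqP => [u0|->]; last exact: dotp0l.
apply/colP => i; rewrite !mxE; apply/eqP.
by rewrite -sqrf_eq0 eq_le sqr_ge0 -u0 sqr_coord_le_dotp.
Qed.

Lemma enorm_ge0 u : 0 <= enorm u.
Proof. exact: sqrtr_ge0. Qed.

Lemma sqr_enorm u : enorm u ^+ 2 = dotp u u.
Proof. by rewrite sqr_sqrtr // dotp_ge0. Qed.

Lemma enorm_le u c : 0 <= c -> (enorm u <= c) = (dotp u u <= c ^+ 2).
Proof. by move=> c0; rewrite -sqr_enorm ler_pXn2r // nnegrE ?enorm_ge0. Qed.

Lemma mx_entry_le_norm n p (D : 'M[R]_(n, p)) i j : `|D i j| <= `|D|.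
Proof.
rewrite [leRHS]mx_normrE.
exact: (@le_bigmax _ _ _ 0 (fun ij : 'I_n * 'I_p => `|D ij.1 ij.2|) (i, j)).
Qed.

Lemma mx_norm_le n p (D : 'M[R]_(n, p)) c :
  0 <= c -> (forall i j, `|D i j| <= c) -> `|D| <= c.
Proof.
by move=> c0 Dc; rewrite (_ : `|D| = mx_norm D) // mx_normrE; apply: bigmax_le.
Qed.

Lemma norm_le_enorm u : `|u| <= enorm u.
Proof.
apply: mx_norm_le => [|i j]; first exact: enorm_ge0.
rewrite (ord1 j) -sqrtr_sqr ler_sqrt ?dotp_ge0 //.
exact: sqr_coord_le_dotp.
Qed.

Definition qform A u : R := dotp u (A *m u).

Lemma qformZ A a u : qform A (a *: u) = a ^+ 2 * qform A u.
Proof. by rewrite /qform -scalemxAr dotpZl dotpZr mulrA -expr2. Qed.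

Lemma qformN A u : qform A (- u) = qform A u.
Proof. by rewrite /qform mulmxN dotpNl dotpNr opprK. Qed.

Lemma dotp_sym A u v : A^T = A -> dotp u (A *m v) = dotp v (A *m u).
Proof. by move=> sA; rewrite dotpC dotp_mulmxl sA. Qed.

Lemma qformD A u v : A^T = A ->
  qform A (u + v) = qform A u + qform A v + 2 * dotp u (A *m v).
Proof.
move=> sA; rewrite /qform mulmxDr !dotpDl !dotpDr (dotp_sym v u sA).
by ring.
Qed.

(** Bound each product [u i * u j] by half the sum of the squares. *)
Lemma qform_le_norm A u : `|qform A u| <= m%:R * `|A| * dotp u u.
Proof.
have -> : qform A u = \sum_i \sum_j A i j * (u i 0 * u j 0).
  rewrite /qform dotpE; apply: eq_bigr => i _.
  rewrite mxE mulr_sumr; apply: eq_bigr => j _; ring.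
apply: (@le_trans _ _ (\sum_i \sum_j `|A| * ((u i 0 ^+ 2 + u j 0 ^+ 2) / 2))).
  apply: (le_trans (ler_norm_sum _ _ _)); apply: ler_sum => i _.
  apply: (le_trans (ler_norm_sum _ _ _)); apply: ler_sum => j _.
  rewrite normrM; apply: ler_pM => //; first exact: mx_entry_le_norm.
  rewrite ler_norml; apply/andP; split.
    have := sqr_ge0 (u i 0 + u j 0); nra.
  have := sqr_ge0 (u i 0 - u j 0); nra.
have -> : \sum_(i < m) \sum_(j < m) `|A| * ((u i 0 ^+ 2 + u j 0 ^+ 2) / 2)
        = `|A| * (m%:R * dotp u u).
  have e2 : \sum_i u i 0 ^+ 2 = dotp u u.
    by rewrite dotpE; apply: eq_bigr => i _; rewrite expr2.
  transitivity (\sum_(i < m) `|A| * ((m%:R * u i 0 ^+ 2 + dotp u u) / 2)).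
    apply: eq_bigr => i _.
    by rewrite -mulr_sumr -mulr_suml big_split /= sumr_const card_ord e2 mulr_natl.
  rewrite -mulr_sumr -mulr_suml big_split /= -mulr_sumr e2 sumr_const card_ord.
  by rewrite -mulr_natl; field.
by rewrite mulrA (mulrC m%:R).
Qed.

Lemma mulmx_norm_bound A u :
  dotp (A *m u) (A *m u) <= m%:R * `|A^T *m A| * dotp u u.
Proof.
rewrite dotp_mulmxl mulmxA; exact: le_trans (ler_norm _) (qform_le_norm _ _).
Qed.

(** Cauchy-Schwarz for a positive semidefinite form, by the discriminant. *)
Lemma qform_cauchy_schwarz A u v : A^T = A -> (forall w, 0 <= qform A w) ->
  dotp u (A *m v) ^+ 2 <= qform A u * qform A v.
Proof.
move=> sA A0.
have pos t : 0 <= qform A u + t ^+ 2 * qform A v + 2 * t * dotp u (A *m v).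
  have := A0 (u + t *: v); rewrite qformD // qformZ -scalemxAr dotpZr.
  by rewrite mulrA.
have qu := A0 u; have qv := A0 v.
move: (qform A u) (qform A v) (dotp _ _) qu qv pos => a c b a0 c0 pos.
(* for [c = 0] the polynomial is affine and nonnegative, hence constant *)
have [c_eq0|c_neq0] := eqVneq c 0.
  have [->|b0] := eqVneq b 0; first by rewrite c_eq0 expr0n mulr0.
  have := pos (- (a + 1) / (2 * b)).
  have -> : a + (- (a + 1) / (2 * b)) ^+ 2 * c + 2 * (- (a + 1) / (2 * b)) * b
          = -1 by rewrite c_eq0; field.
  by rewrite ler0N1.
have c_gt0 : 0 < c by rewrite lt_neqAle eq_sym c_neq0.
have := pos (- b / c).
have -> : a + (- b / c) ^+ 2 * c + 2 * (- b / c) * b = a - b ^+ 2 / c by field.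
by rewrite subr_ge0 ler_pdivrMr.
Qed.

Lemma dotp_cauchy_schwarz u v : dotp u v ^+ 2 <= dotp u u * dotp v v.
Proof.
have q1 w : qform 1%:M w = dotp w w by rewrite /qform mul1mx.
have := @qform_cauchy_schwarz 1%:M u v (trmx1 _ _).
by rewrite !q1 mul1mx; apply=> w; rewrite q1 dotp_ge0.
Qed.

Let opnorm_set A := [set enorm (A *m x) | x in [set x : 'cV[R]_m | enorm x <= 1]].

Lemma enorm0 : enorm (0 : 'cV[R]_m) = 0.
Proof. by rewrite /enorm dotp0l sqrtr0. Qed.

Lemma opnorm_set_nonempty A : opnorm_set A !=set0.
Proof. by exists (enorm (A *m 0)), 0; rewrite //= enorm0. Qed.

Lemma opnorm_le A c : 0 <= c ->
  (forall u, dotp (A *m u) (A *m u) <= c ^+ 2 * dotp u u) -> opnorm A <= c.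
Proof.
move=> c0 Ac; apply: ge_sup; first exact: opnorm_set_nonempty.
move=> _ [u /= u1 <-]; rewrite enorm_le //; apply: le_trans (Ac u) _.
rewrite ler_piMr ?sqr_ge0 //.
by move: u1; rewrite enorm_le // expr1n.
Qed.

Lemma opnorm_has_sup A : has_sup (opnorm_set A).
Proof.
split; first exact: opnorm_set_nonempty.
exists (Num.sqrt (m%:R * `|A^T *m A|)) => _ [u /= u1 <-].
rewrite enorm_le ?sqrtr_ge0 // sqr_sqrtr ?mulr_ge0 //.
apply: le_trans (mulmx_norm_bound _ _) _.
by rewrite ler_piMr ?mulr_ge0 //; move: u1; rewrite enorm_le // expr1n.
Qed.

Lemma opnorm_ge0 A : 0 <= opnorm A.
Proof.
apply: le_trans (enorm_ge0 (A *m 0)) _.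
by apply: ub_le_sup; [case: (opnorm_has_sup A)|exists 0; rewrite //= enorm0].
Qed.

Lemma enorm_mulmx_le A u : enorm (A *m u) <= opnorm A * enorm u.
Proof.
have [->|u0] := eqVneq u 0; first by rewrite mulmx0 enorm0 mulr0.
have uu : 0 < enorm u.
  by rewrite sqrtr_gt0 lt_neqAle dotp_ge0 eq_sym dotp_eq0 u0.
have enormZ (a : R) w : 0 <= a -> enorm (a *: w) = a * enorm w.
  move=> a0; rewrite /enorm dotpZl dotpZr mulrA -expr2 sqrtrM ?sqr_ge0 //.
  by rewrite sqrtr_sqr ger0_norm.
rewrite -ler_pdivrMr // mulrC -enormZ ?invr_ge0 ?enorm_ge0 // scalemxAr.
apply: ub_le_sup; first by case: (opnorm_has_sup A).
exists ((enorm u)^-1 *: u) => //=.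
by rewrite enormZ ?invr_ge0 ?enorm_ge0 // mulVf // gt_eqF.
Qed.

Lemma qform_le_opnorm A u : qform A u <= opnorm A * dotp u u.
Proof.
have h : dotp u (A *m u) ^+ 2 <= (opnorm A * dotp u u) ^+ 2.
  apply: le_trans (dotp_cauchy_schwarz _ _) _.
  rewrite -(sqr_enorm (A *m u)) -sqr_enorm -!exprMn.
  rewrite ler_pXn2r ?nnegrE ?mulr_ge0 ?sqr_ge0 ?opnorm_ge0 ?enorm_ge0 //.
  rewrite expr2 mulrCA ler_wpM2l ?enorm_ge0 //.
  exact: enorm_mulmx_le.
rewrite -(ger0_norm (mulr_ge0 (opnorm_ge0 A) (dotp_ge0 u))).
by apply: le_trans (ler_norm _) _; rewrite -ler_sqr ?nnegrE // !real_normK ?num_real.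
Qed.

Lemma spd_qform_ge0 A u : is_spd A -> 0 <= qform A u.
Proof.
move=> [_ pA]; have [->|/pA/ltW//] := eqVneq u 0.
by rewrite /qform dotp0l.
Qed.

Lemma spd_unitmx A : is_spd A -> A \in unitmx.
Proof.
move=> [sA pA]; rewrite -unitmx_tr -row_free_unit -kermx_eq0.
apply/rowV0P => v /sub_kermxP vA.
have Av : A *m v^T = 0 by rewrite -[A]trmxK -trmx_mul vA trmx0.
apply/eqP; rewrite -trmx_eq0; apply: contraT => /pA.
by rewrite Av dotp0r ltxx.
Qed.

(** Cauchy-Schwarz for the form [A], applied to [u] and [A^-1 u]. *)
Lemma dotp_le_opnorm_invmx A u : is_spd A ->
  dotp u u <= opnorm (invmx A) * qform A u.
Proof.
move=> spdA; have [sA pA] := spdA; have uA := spd_unitmx spdA.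
have := @qform_cauchy_schwarz A u (invmx A *m u) sA (fun w => spd_qform_ge0 w spdA).
rewrite {2}/qform mulmxA mulmxV // mul1mx.
have le1 : dotp (invmx A *m u) u <= opnorm (invmx A) * dotp u u.
  by rewrite dotpC; exact: qform_le_opnorm.
move=> cs; have [->|u0] := eqVneq u 0.
  by rewrite dotp0l mulr_ge0 ?opnorm_ge0 // spd_qform_ge0.
have uu : 0 < dotp u u by rewrite lt_neqAle dotp_ge0 eq_sym dotp_eq0 u0.
rewrite -(ler_pM2r uu) -expr2; apply: le_trans cs _.
by rewrite mulrAC mulrC ler_wpM2r // spd_qform_ge0.
Qed.

End QuadraticForms.

(** * Uniform bounds on a compact set of forms *)

Section Compactness.
Context {R : realType}.

Lemma mx_norm_tr n p (D : 'M[R]_(n, p)) : `|D^T| = `|D|.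
Proof.
have le_tr n' p' (D' : 'M[R]_(n', p')) : `|D'^T| <= `|D'|.
  by apply: mx_norm_le => // i j; rewrite mxE mx_entry_le_norm.
by apply/eqP; rewrite eq_le le_tr -{1}[D]trmxK le_tr.
Qed.

Lemma trmx_continuous n p : continuous (fun D : 'M[R]_(n, p) => D^T).
Proof.
move=> D P /nbhs_ballP [e /= e0 eP]; apply/nbhs_ballP; exists e => // D'.
rewrite mx_norm_ball => DD'; apply: eP.
by rewrite mx_norm_ball /ball_ /= -linearB /= mx_norm_tr.
Qed.

Lemma compact_closure_bounded (m : nat) (Omega : set 'cV[R]_m) :
  bounded_set Omega -> compact (closure Omega).
Proof.
move=> [c [creal Oc]].
(* Heine-Borel for row vectors, transported by transposition *)
pose tr := fun y : 'rV[R]_m => y^T.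
have -> : closure Omega = tr @` (tr @^-1` closure Omega).
  apply/seteqP; split => [x Ox|_ [y /= Oy <-] //].
  by exists x^T; rewrite /tr /= trmxK.
apply: continuous_compact; first exact/continuous_subspaceT/trmx_continuous.
apply: bounded_closed_compact; last first.
  apply: closed_comp => [x _|]; [exact: trmx_continuous|exact: closed_closure].
exists (c + 1); split; first by rewrite realD.
move=> b cb y /= Oy; rewrite -mx_norm_tr.
have [z [Oz]] := Oy _ (nbhsx_ballx _ _ ltr01).
rewrite -ball_normE /= => yz.
have cb1 : c < b - 1 by rewrite ltrBrDr.
have zb := Oc _ cb1 _ Oz.
have -> : y^T = (y^T - z) + z by rewrite subrK.
apply: le_trans (ler_normD _ _) _.
by rewrite -[b](subrK 1) addrC lerD // ltW.
Qed.

Lemma within_continuous_dist (V W : normedModType R) (K : set V) (f : V -> W) x e :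
  {within K, continuous f} -> K x -> 0 < e ->
  exists2 d, 0 < d & forall y, K y -> `|x - y| < d -> `|f x - f y| < e.
Proof.
move=> cf Kx e0.
have /cvgrPdist_lt/(_ _ e0) := cf x.
rewrite /nbhs /= -nbhs_subspace_in // => /nbhs_normP [d /= d0 dP].
by exists d => // y Ky xy; exact: dP.
Qed.

Lemma compact_uniformly_continuous (V W : normedModType R) (K : set V) (f : V -> W) e :
  compact K -> {within K, continuous f} -> 0 < e ->
  exists2 d, 0 < d &
    forall x y, K x -> K y -> `|x - y| < d -> `|f x - f y| < e.
Proof.
move=> /compact_near_coveringP cK cf e0.
have near_d : \forall d \near 0^'+, K `<=` [set x |
    forall y, K x -> K y -> `|x - y| < d -> `|f x - f y| < e].
  apply: cK => x Kx.
  have [d d0 dP] := within_continuous_dist cf Kx (divr_gt0 e0 (ltr0Sn _ 1)).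
  have d20 : 0 < d / 2 by rewrite divr_gt0.
  near=> x' d' => y Kx' Ky x'y.
  have xx' : `|x - x'| < d / 2 by near: x'; exact: cvgr_dist_lt.
  have d'd : d' <= d / 2 by near: d'; exact: nbhs_right_le.
  have xx'd : `|x - x'| < d.
    by rewrite (lt_trans xx') // ltr_pdivrMr // ltr_pMr // ltrDl.
  have xyd : `|x - y| < d.
    rewrite -(subrKA x') (le_lt_trans (ler_normD _ _)) //.
    by rewrite [d]splitr ltrD // (lt_le_trans x'y).
  rewrite -(subrKA (f x)) (le_lt_trans (ler_normD _ _)) // [e]splitr.
  by rewrite ltrD ?dP // distrC dP.
near (0 : R)^'+ => d.
exists d; first by near: d; exact: nbhs_right_gt.
move=> x y Kx Ky; have : (K `<=` [set x |
    forall y, K x -> K y -> `|x - y| < d -> `|f x - f y| < e]) by near: d.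
by move=> /(_ x Kx y Kx Ky).
Unshelve. all: by end_near. Qed.

Lemma opnorm_invmx_le (m : nat) (A : 'M[R]_m) a : 0 < a -> A \in unitmx ->
  (forall u, a * dotp u u <= qform A u) -> opnorm (invmx A) <= a^-1.
Proof.
move=> a0 uA Aa; apply: opnorm_le => [|u]; first by rewrite invr_ge0 ltW.
set w := invmx A *m u.
have := Aa w; rewrite /qform {1}/w mulKVmx // => aw.
have cs := dotp_cauchy_schwarz w u.
have u0 := dotp_ge0 u.
have [w0|w0] := eqVneq w 0.
  by rewrite w0 dotp0l mulr_ge0 // exprn_ge0 // invr_ge0 ltW.
have ww : 0 < dotp w w by rewrite lt_neqAle dotp_ge0 eq_sym dotp_eq0 w0.
rewrite exprVn mulrC ler_pdivlMr ?exprn_gt0 // -(ler_pM2r ww).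
apply: le_trans _ (le_trans cs _); last by rewrite mulrC.
have -> : dotp w w * a ^+ 2 * dotp w w = (a * dotp w w) ^+ 2 by ring.
have aw0 : 0 <= a * dotp w w by rewrite mulr_ge0 // ltW.
by rewrite ler_pXn2r // nnegrE (le_trans aw0 aw).
Qed.

Lemma opnorm_le_norm (m : nat) (A : 'M[R]_m) : opnorm A <= m%:R * `|A|.
Proof.
apply: opnorm_le => [|u]; first by rewrite mulr_ge0.
apply: le_trans (mulmx_norm_bound _ _) _.
rewrite ler_wpM2r ?dotp_ge0 // expr2 -mulrA ler_wpM2l //.
apply: mx_norm_le => [|i j]; first by rewrite mulr_ge0 // mulr_ge0.
rewrite mxE; apply: le_trans (ler_norm_sum _ _ _) _.
apply: (@le_trans _ _ (\sum_(k < m) `|A| * `|A|)).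
  by apply: ler_sum => k _; rewrite normrM mxE ler_pM // mx_entry_le_norm.
by rewrite sumr_const card_ord mulr_natl mulrnAr.
Qed.

Lemma spd_coercive (m : nat) (A : 'M[R]_m) u : is_spd A ->
  (opnorm (invmx A) + 1)^-1 * dotp u u <= qform A u.
Proof.
move=> spdA; have n0 : 0 < opnorm (invmx A) + 1 by rewrite ltr_wpDl // opnorm_ge0.
rewrite mulrC ler_pdivrMr // mulrC.
apply: le_trans (dotp_le_opnorm_invmx u spdA) _.
by rewrite ler_wpM2r ?spd_qform_ge0 // lerDl.
Qed.

(** Near a point, coercivity of the form survives with half the constant;
    compactness makes the constants uniform. *)
Lemma compact_spd_opnorm_bounded (m : nat) (K : set 'cV[R]_m)
    (M : 'cV[R]_m -> 'M[R]_m) :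
  compact K -> {within K, continuous M} -> (forall z, K z -> is_spd (M z)) ->
  exists C, forall z, K z -> opnorm (M z) <= C /\ opnorm (invmx (M z)) <= C.
Proof.
move=> /compact_near_coveringP cK cM spdM.
have near_n : \forall n \near \oo, K `<=` [set z | K z ->
    opnorm (M z) <= n%:R /\ opnorm (invmx (M z)) <= n%:R].
  apply: cK => x Kx.
  set a := (opnorm (invmx (M x)) + 1)^-1.
  have a0 : 0 < a by rewrite invr_gt0 ltr_wpDl // opnorm_ge0.
  have e0 : 0 < a / 2 / (m%:R + 1) by rewrite !divr_gt0 // ltr_wpDl.
  have [d d0 dP] := within_continuous_dist cM Kx e0.
  near=> y n => Ky.
  have n1 : m%:R * (`|M x| + a / 2 / (m%:R + 1)) <= n%:R.
    by near: n; exact: nbhs_infty_ger.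
  have n2 : (a / 2)^-1 <= n%:R by near: n; exact: nbhs_infty_ger.
  have xy : `|x - y| < d by near: y; exact: cvgr_dist_lt.
  have Mxy := ltW (dP y Ky xy).
  have Mxy' : m%:R * `|M x - M y| <= a / 2.
    apply: le_trans (ler_wpM2l _ Mxy) _ => //.
    rewrite mulrA ler_pdivrMr ?ltr_wpDl // mulrC ler_wpM2l ?divr_ge0 // ?ltW //.
    by rewrite ltrDl.
  have coer u : a / 2 * dotp u u <= qform (M y) u.
    have q1 := spd_coercive u (spdM x Kx).
    have := le_trans (ler_norm _) (qform_le_norm (M x - M y) u).
    have -> : qform (M x - M y) u = qform (M x) u - qform (M y) u.
      by rewrite /qform mulmxBl dotpDr dotpNr.
    have := ler_wpM2r (dotp_ge0 u) Mxy'; rewrite -/a in q1; nra.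
  split.
    apply: le_trans (opnorm_le_norm _) _.
    apply: (@le_trans _ _ (m%:R * (`|M x| + a / 2 / (m%:R + 1)))).
      rewrite ler_wpM2l // -[M y](subKr (M x)).
      by rewrite (le_trans (ler_normB _ _)) // lerD2l.
    exact: n1.
  apply: le_trans (opnorm_invmx_le _ (spd_unitmx (spdM y Ky)) coer) _.
    by rewrite divr_gt0.
  exact: n2.
near \oo => n; exists n%:R => z Kz.
have : (K `<=` [set z | K z ->
    opnorm (M z) <= n%:R /\ opnorm (invmx (M z)) <= n%:R]) by near: n.
exact.
Unshelve. all: by end_near. Qed.

End Compactness.

(** * Integer vectors and bases *)

Section IntegerVectors.
Context {R : realType}.

Lemma zvecD m (u v : 'cV[int]_m) : zvec (u + v) = zvec u + zvec v :> 'cV[R]_m.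
Proof. exact: map_mxD. Qed.

Lemma zvecB m (u v : 'cV[int]_m) : zvec (u - v) = zvec u - zvec v :> 'cV[R]_m.
Proof. exact: map_mxB. Qed.

Lemma zvecN m (u : 'cV[int]_m) : zvec (- u) = - zvec u :> 'cV[R]_m.
Proof. exact: map_mxN. Qed.

Lemma zvec0 m : zvec (0 : 'cV[int]_m) = 0 :> 'cV[R]_m.
Proof. exact: map_mx0. Qed.

Lemma zvec_sum m (I : Type) (r : seq I) (P : pred I) (F : I -> 'cV[int]_m) :
  zvec (\sum_(i <- r | P i) F i) = \sum_(i <- r | P i) zvec (F i) :> 'cV[R]_m.
Proof. exact: map_mx_sum. Qed.

Lemma zvec_mul m n (B : 'M[int]_(m, n)) v :
  zvec (B *m v) = map_mx intr B *m zvec v :> 'cV[R]_m.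
Proof. exact: map_mxM. Qed.

Lemma one_le_dotp_zvec m (z : 'cV[int]_m) : z != 0 -> 1 <= dotp (zvec z) (zvec z) :> R.
Proof.
move=> z0; have [i zi] : exists i, z i 0 != 0.
  apply/existsP; apply: contraNT z0; rewrite negb_exists => /forallP h.
  by apply/eqP/colP => i; rewrite mxE; apply/eqP; rewrite -[_ == _]negbK.
apply: le_trans (sqr_coord_le_dotp _ i); rewrite mxE -rmorphXn /=.
by rewrite ler1z -gtz0_ge1 exprn_even_gt0.
Qed.

Lemma is_zbasisP m (B : 'M[int]_m) : is_zbasis B <-> B \in unitmx.
Proof.
rewrite unitmxE /is_zbasis; split.
  by case=> ->.
by rewrite unfold_in /= => /orP[] /eqP; [left|right].
Qed.

Lemma map_intr_unitmx m (B : 'M[int]_m) :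
  (map_mx intr B : 'M[R]_m) \in unitmx <-> \det B != 0.
Proof. by rewrite unitmxE det_map_mx unitfE intr_eq0. Qed.

End IntegerVectors.

Definition replace_col (S : Type) m (B : 'M[S]_m) (k : 'I_m) (v : 'cV[S]_m) : 'M[S]_m :=
  \matrix_(i, j) if j == k then v i 0 else B i j.

Lemma col_replace_col (S : Type) m (B : 'M[S]_m) k v j :
  col j (replace_col B k v) = if j == k then v else col j B.
Proof. by apply/colP => i; rewrite !mxE; case: ifP => //; rewrite mxE. Qed.

(** Expand along the column [k], whose cofactors do not involve its entries. *)
Lemma det_replace_col (S : comRingType) m (B : 'M[S]_m) k v :
  \det (replace_col B k v) = (\adj B *m v) k 0.
Proof.
rewrite (expand_det_col _ k) mxE; apply: eq_bigr => i _.
rewrite !mxE eqxx mulrC; congr (_ * _).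
rewrite /cofactor; congr (_ * \det _).
by apply/matrixP => p q; rewrite !mxE [lift k q == k]eq_sym (negbTE (neq_lift _ _)).
Qed.

(** * Reduced bases in dimension at most four *)

Section Reduction.
Context {R : realType} {m : nat} (A : 'M[R]_m) (spdA : is_spd A).
Implicit Types (B : 'M[int]_m).

Definition energy B : R := \sum_k qform A (zvec (col k B)).

Lemma energy_replace_col B k v :
  energy (replace_col B k v)
  = energy B - qform A (zvec (col k B)) + qform A (zvec v).
Proof.
rewrite /energy (bigD1 k) //= [in RHS](bigD1 k) //= col_replace_col eqxx.
rewrite [X in _ = X + _]addrAC subrr add0r addrC; congr (_ + _).
by apply: eq_bigr => j /negbTE jk; rewrite col_replace_col jk.
Qed.

Lemma qform_le_energy B k : qform A (zvec (col k B)) <= energy B.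
Proof.
rewrite /energy (bigD1 k) //= lerDl sumr_ge0 // => j _.
exact: spd_qform_ge0.
Qed.

(** Round each [c i] up or down at random, with mean zero: the expected value
    of the form is the sum of the variances times [qform A (b i)], and these
    variances are at most a quarter.  Some outcome does at least as well as the
    mean; the induction makes the choices one coefficient at a time. *)
Lemma qform_rounding (I : eqType) (r : seq I) (b : I -> 'cV[R]_m) (c : I -> R) :
  uniq r -> exists d : I -> R,
    (forall i, c i - d i \is a Num.int /\ `|d i| < 1) /\
    qform A (\sum_(i <- r) d i *: b i)
      <= \sum_(i <- r | d i != 0) qform A (b i) / 4.
Proof.
elim: r => [_|i r IH /= /andP[ir /IH [d [dc dq]]]].
  exists (fun i => c i - (Num.floor (c i))%:~R); split => [i|].
    rewrite subKr intr_int; split=> //.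
    have /andP[lo hi] := floor_itv (c i).
    by rewrite ger0_norm ?subr_ge0 // ltrBlDl -intrD1.
  by rewrite !big_nil /qform dotp0l.
set u := \sum_(j <- r) _ in dq.
pose upd t j := if j == i then t else d j.
have updE t : \sum_(j <- i :: r) upd t j *: b j = u + t *: b i.
  rewrite big_cons {1}/upd eqxx addrC; congr (_ + _).
  apply: eq_big_seq => j jr; rewrite /upd.
  by case: eqP jr ir => // -> ->.
have updS t : \sum_(j <- i :: r | upd t j != 0) qform A (b j) / 4
            = (if t != 0 then qform A (b i) / 4 else 0)
            + \sum_(j <- r | d j != 0) qform A (b j) / 4.
  rewrite big_cons {1}/upd eqxx big_seq_cond.
  rewrite [in RHS]big_seq_cond.
  have -> : \sum_(j <- r | (j \in r) && (upd t j != 0)) qform A (b j) / 4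
          = \sum_(j <- r | (j \in r) && (d j != 0)) qform A (b j) / 4.
    apply: eq_bigl => j; rewrite /upd.
    by have [->|//] := eqVneq j i; rewrite (negbTE ir).
  by case: ifP; rewrite ?add0r.
pose f := c i - (Num.floor (c i))%:~R.
have /andP[lo hi] := floor_itv (c i).
have f0 : 0 <= f by rewrite subr_ge0.
have f1 : f < 1 by rewrite ltrBlDl -intrD1.
have good t : c i - t \is a Num.int -> `|t| < 1 ->
    qform A (u + t *: b i) <= (if t != 0 then qform A (b i) / 4 else 0)
            + \sum_(j <- r | d j != 0) qform A (b j) / 4 ->
    exists d0 : I -> R,
    (forall i0, c i0 - d0 i0 \is a Num.int /\ `|d0 i0| < 1) /\
    qform A (\sum_(i0 <- i :: r) d0 i0 *: b i0)
      <= \sum_(i0 <- i :: r | d0 i0 != 0) qform A (b i0) / 4.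
  move=> t1 t2 tq; exists (upd t); split; last by rewrite updE updS.
  by move=> j; rewrite /upd; case: eqP => [->|_].
have fint : c i - f \is a Num.int by rewrite subKr intr_int.
have [f_eq0|f_neq0] := eqVneq f 0.
  apply: (good 0); rewrite ?normr0 ?ltr01 //; first by rewrite -f_eq0.
  by rewrite scale0r addr0 eqxx add0r.
have fgt0 : 0 < f by rewrite lt_neqAle eq_sym f_neq0.
have sA : A^T = A by case: spdA.
have qE t : qform A (u + t *: b i)
    = qform A u + t ^+ 2 * qform A (b i) + 2 * t * dotp u (A *m b i).
  by rewrite qformD // qformZ -scalemxAr dotpZr mulrA.
have qb := spd_qform_ge0 (b i) spdA.
have [le1|gt1] := leP (qform A (u + f *: b i)) (qform A (b i) / 4 + qform A u).
  apply: (good f) => //; first by rewrite ger0_norm.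
  by rewrite f_neq0 (le_trans le1) // lerD2l.
have [le2|gt2] := leP (qform A (u + (f - 1) *: b i)) (qform A (b i) / 4 + qform A u).
  apply: (good (f - 1)).
  - by rewrite opprB addrCA rpredD ?rpred1.
  - by rewrite ltr0_norm ?subr_lt0 // opprB ltrBlDl ltrDr.
  - by rewrite subr_eq0 (lt_eqF f1) (le_trans le2) // lerD2l.
move: gt1 gt2; rewrite !qE.
move: (qform A u) (qform A (b i)) (dotp _ _) qb => p q s q0 gt1 gt2.
exfalso.
(* with weights [1 - f] and [f] the two roundings have mean 0, variance [f * (1 - f)] *)
have : (1 - f) * (q / 4 + p) + f * (q / 4 + p) <
   (1 - f) * (p + f ^+ 2 * q + 2 * f * s)
   + f * (p + (f - 1) ^+ 2 * q + 2 * (f - 1) * s).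
  by rewrite ltrD // ltr_pM2l // subr_gt0.
have := mulr_ge0 (sqr_ge0 (f - 1 / 2)) q0.
nra.
Qed.

(** Only the first of the two minimizations; the second one, of the absolute
    value of the determinant, is the descent below. *)
Definition energy_minimal B :=
  \det B != 0 /\ forall B', \det B' != 0 -> energy B <= energy B'.

(** Coercivity confines the competitors of the identity matrix to a finite box. *)
Lemma exists_energy_minimal : exists B, energy_minimal B.
Proof.
pose C := opnorm (invmx A).
pose N := Num.bound (C * energy 1%:M).
have E0 : 0 <= energy 1%:M by rewrite sumr_ge0 // => k _; exact: spd_qform_ge0.
have box B i j : energy B <= energy 1%:M -> (`|B i j| <= N)%N.
  move=> le1; rewrite -(ler_nat R) natr_absz intr_norm.
  have le2 : (B i j)%:~R ^+ 2 <= C * energy 1%:M :> R.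
    have := sqr_coord_le_dotp (zvec (col j B) : 'cV[R]_m) i; rewrite !mxE => h.
    apply: le_trans h (le_trans (dotp_le_opnorm_invmx _ spdA) _).
    rewrite ler_wpM2l ?opnorm_ge0 // (le_trans _ le1) //.
    exact: qform_le_energy.
  apply: le_trans (le_trans le2 _); last first.
    by rewrite ltW // archi_boundP // mulr_ge0 // opnorm_ge0.
  rewrite -real_normK ?num_real // -intr_norm -rmorphXn ler_int /=.
  have : 0 <= `|B i j| by [].
  move: `|B i j| => n n0; nia.
pose dec (X : 'M['I_(N.*2.+1)]_m) : 'M[int]_m :=
  \matrix_(i, j) ((X i j : nat)%:Z - N%:Z).
pose enc B : 'M['I_(N.*2.+1)]_m := \matrix_(i, j) inord `|B i j + N%:Z|.
have encK B : energy B <= energy 1%:M -> dec (enc B) = B.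
  move=> le1; apply/matrixP => i j; rewrite !mxE inordK.
    by have := box B i j le1; lia.
  by have := box B i j le1; lia.
have P1 : \det (dec (enc 1%:M)) != 0 by rewrite encK // det1.
pose X := [arg min_(X < enc 1%:M | \det (dec X) != 0) energy (dec X)]%O.
have [X0 minX] : \det (dec X) != 0 /\
    forall Y, \det (dec Y) != 0 -> energy (dec X) <= energy (dec Y).
  by rewrite /X; case: arg_minP => // Y; split.
exists (dec X); split=> // B' detB'.
have [le1|/ltW] := leP (energy B') (energy 1%:M).
  by rewrite -[B'](encK _ le1) minX // encK.
by apply: le_trans; have := minX _ P1; rewrite encK.
Qed.

(** Write a lattice vector outside the span of the columns in their basis,
    round its coordinates, and substitute the resulting vector for the column
    of largest form with nonzero coordinate [d k]: the form of the new vector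
    is at most [m / 4] times that of the old one, and the determinant is
    multiplied by [d k], which lies strictly between -1 and 1. *)
Lemma energy_minimal_descent B : (m <= 4)%N -> energy_minimal B ->
  ~ is_zbasis B -> exists2 B', energy_minimal B' & (`|\det B'| < `|\det B|)%N.
Proof.
move=> m4 [detB minB] /is_zbasisP nB.
pose Br : 'M[R]_m := map_mx intr B.
have uBr : Br \in unitmx by exact/map_intr_unitmx.
have [j [i cij]] : exists j i, invmx Br i j \isn't a Num.int.
  apply: contrapT => /forallNP h; apply: nB.
  pose B' : 'M[int]_m := \matrix_(i, j) Num.floor (invmx Br i j).
  have B'E : map_mx intr B' = invmx Br.
    apply/matrixP => i j; rewrite !mxE floorK //.
    by apply: contrapT => /negP ij; apply: (h j); exists i.
  have : B *m B' = 1%:M.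
    apply/matrixP => i j; apply: (@intr_inj R).
    have : map_mx intr (B *m B') = 1%:M :> 'M[R]_m.
      by rewrite map_mxM /= B'E mulmxV.
    move=> /matrixP/(_ i j); rewrite !mxE => ->.
    by case: eqP.
  by move=> /mulmx1_unit[].
pose c i := invmx Br i j.
have [d [dc dq]] := @qform_rounding 'I_m (index_enum 'I_m)
  (fun k => zvec (col k B)) c (index_enum_uniq _).
pose v := delta_mx j 0 - B *m (\col_k Num.floor (c k - d k)).
have vE : zvec v = Br *m \col_k d k :> 'cV[R]_m.
  rewrite zvecB zvec_mul -/Br.
  have -> : zvec (\col_k Num.floor (c k - d k)) = \col_k (c k - d k) :> 'cV[R]_m.
    apply/colP => k; rewrite !mxE floorK //; by case: (dc k).
  have -> : \col_k (c k - d k) = invmx Br *m delta_mx j 0 - \col_k d k.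
    by rewrite -colE; apply/colP => k; rewrite !mxE.
  rewrite mulmxBr mulKVmx // -[zvec _]/(map_mx _ _) map_delta_mx.
  by rewrite opprB addrCA subrr addr0.
have vq : qform A (zvec v) <= \sum_(k | d k != 0) qform A (zvec (col k B)) / 4.
  rewrite vE; have -> // : Br *m \col_k d k = \sum_k d k *: zvec (col k B).
  apply/colP => p; rewrite !mxE summxE; apply: eq_bigr => q _.
  by rewrite !mxE mulrC.
have di : d i != 0.
  apply: contraNneq cij => di; have [] := dc i.
  by rewrite di subr0.
(* the largest of the at most [m] terms of the sum in [vq] *)
pose k := [arg max_(k > i | d k != 0) qform A (zvec (col k B))]%O.
have [dk maxk] : d k != 0 /\ forall l, d l != 0 ->
    qform A (zvec (col l B)) <= qform A (zvec (col k B)).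
  by rewrite /k; case: arg_maxP.
have detE : (\det (replace_col B k v))%:~R = (\det B)%:~R * d k :> R.
  have : ((\adj B *m v) k 0)%:~R = (zvec (\adj B *m v) k 0 : R) by rewrite [RHS]mxE.
  rewrite det_replace_col => ->; rewrite zvec_mul vE mulmxA.
  rewrite -map_mxM /= mul_adj_mx map_scalar_mx mul_scalar_mx !mxE.
  by [].
have det0 : \det (replace_col B k v) != 0.
  by rewrite -(intr_eq0 R) detE mulf_neq0 // intr_eq0.
have qk := spd_qform_ge0 (zvec (col k B)) spdA.
exists (replace_col B k v).
  split=> // B' /minB; apply: le_trans.
  rewrite energy_replace_col -addrA gerDl addrC subr_le0.
  apply: le_trans vq _.
  apply: (@le_trans _ _ (\sum_(l < m) qform A (zvec (col k B)) / 4)).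
    rewrite big_mkcond ler_sum // => l _.
    case: ifP => [/maxk h|_]; last by rewrite divr_ge0.
    by rewrite ler_wpM2r.
  rewrite sumr_const card_ord -[_ *+ m]mulr_natl mulrCA ler_piMr //.
  by rewrite ler_pdivrMr // mul1r ler_nat.
rewrite -(ltr_nat R) !natr_absz !intr_norm detE normrM gtr_pMr.
  by case: (dc k).
by rewrite normr_gt0 intr_eq0.
Qed.

(** Exchanging a column for a lattice vector that has a nonzero coordinate
    along it keeps the matrix nonsingular, so it cannot lower the energy.
    Equivalently, the columns realize the successive minima of the lattice; the
    bound by the energy of the identity keeps them in a ball that is uniform
    over a compact family of forms. *)
Lemma exists_reduced_zbasis : (m <= 4)%N -> exists B,
  [/\ is_zbasis B,
      forall k, qform A (zvec (col k B)) <= energy 1%:M &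
      forall k (z : 'cV[int]_m), (invmx B *m z) k 0 != 0 ->
        qform A (zvec (col k B)) <= qform A (zvec z)].
Proof.
move=> m4.
have [B [minB zB]] : exists B, energy_minimal B /\ is_zbasis B.
  have [B minB] := exists_energy_minimal.
  have [n] := ubnP `|\det B|%N.
  elim: n B minB => [//|n IH] B minB Bn.
  have [zB|/(energy_minimal_descent m4 minB)[B' minB' lt]] := pselect (is_zbasis B).
    by exists B.
  by apply: (IH B') => //; exact: leq_trans lt Bn.
have [detB leB] := minB.
exists B; split=> // [k|k z zk].
  by rewrite (le_trans (qform_le_energy _ _)) // leB // det1.
have := leB (replace_col B k z).
rewrite energy_replace_col -addrA lerDl addrC subr_ge0; apply.
rewrite det_replace_col.
have uB : B \in unitmx by apply/is_zbasisP.
move: zk; rewrite /invmx uB -scalemxAl mxE mulf_eq0 negb_or => /andP[_].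
by [].
Qed.

End Reduction.

(** * Convex hulls of finite sets *)

Section Hull.
Context {R : realType} {m : nat}.
Implicit Types (S : {fset 'cV[R]_m}).

Lemma hull_elim (I : finType) (v : I -> 'cV[R]_m) S p :
  (forall u, u \in S -> exists i, u = v i) -> hull S p ->
  exists w : I -> R,
    [/\ forall i, 0 <= w i, \sum_i w i = 1 & p = \sum_i w i *: v i].
Proof.
move=> Sv [w [w0 w1 ->]].
(* [v] may repeat values: the weight of [u] goes to a single index of [u] *)
pose g u := [pick i | v i == u].
exists (fun i => \sum_(u <- S) if g u == Some i then w u else 0); split.
- move=> i; rewrite big_seq sumr_ge0 // => u uS.
  by case: ifP => // _; exact: w0.
- rewrite exchange_big /= -[RHS]w1; apply: eq_big_seq => u uS.
  rewrite /g; case: pickP => [i vi|h]; last first.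
    by have [i ui] := Sv u uS; have := h i; rewrite ui eqxx.
  by rewrite -big_mkcond /= (big_pred1 i) // => j /=; rewrite eq_sym.
- under [RHS]eq_bigr do rewrite scaler_suml.
  rewrite exchange_big /=; apply: eq_big_seq => u uS.
  rewrite /g; case: pickP => [i /eqP vi|h]; last first.
    by have [i ui] := Sv u uS; have := h i; rewrite ui eqxx.
  rewrite (bigD1 i) //= eqxx vi big1 ?addr0 // => j /negbTE ji.
  by rewrite (_ : (Some i == Some j) = (i == j)) // eq_sym ji scale0r.
Qed.

Lemma hull_intro (I : finType) (v : I -> 'cV[R]_m) (w : I -> R) (S : {fset 'cV[R]_m}) :
  (forall i, 0 <= w i) -> \sum_i w i = 1 -> (forall i, w i != 0 -> v i \in S) ->
  hull S (\sum_i w i *: v i).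
Proof.
move=> w0 w1 wS.
have inner (V : nmodType) (F : I -> V) i : (w i = 0 -> F i = 0) ->
    \sum_(u <- S | v i == u) F i = F i.
  move=> F0; have [/F0 ->|/wS viS] := eqVneq (w i) 0; first by rewrite big1.
  rewrite big_mkcond (bigD1_seq (v i)) ?fset_uniq //= eqxx big1 ?addr0 // => u uv.
  by rewrite eq_sym (negbTE uv).
exists (fun u => \sum_(i | v i == u) w i); split.
- by move=> u _; rewrite sumr_ge0.
- rewrite (exchange_big_dep predT) //= -[RHS]w1; apply: eq_bigr => i _.
  exact: inner.
- under [RHS]eq_bigr do rewrite scaler_suml.
  rewrite (exchange_big_dep predT) //=; apply: eq_bigr => i _.
  rewrite (eq_bigr (fun=> w i *: v i)) => [|u /eqP -> //].
  by rewrite (inner _ (fun i => w i *: v i)) // => ->; rewrite scale0r.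
Qed.

Lemma hull_subset (S S' : {fset 'cV[R]_m}) : (S `<=` S')%fset -> hull S `<=` hull S'.
Proof.
move=> /fsubsetP SS' p /(@hull_elim S (fun u => val u))[].
  by move=> u uS; exists [` uS]%fset.
move=> w [w0 w1 ->]; apply: hull_intro => // i _.
exact/SS'/valP.
Qed.

End Hull.

(** * Vertices of acute meshes *)

Section Stability.
Context {R : realType} {m : nat}.
Implicit Types (T : {fset {fset 'cV[R]_m}}).

(** The simplices of an acute mesh cover all directions from the origin, so
    each lattice vector is a nonnegative combination of the vertices of one of
    them; the coefficients are integers because these vertices are a basis. *)
Lemma acute_mesh_cone (A : 'M[R]_m) T (e : 'cV[int]_m) : is_acute_mesh A T ->
  exists S B a, [/\ S \in T, is_zbasis B, forall j, zvec (col j B) \in S,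
    forall i j : 'I_m, i != j ->
      (dotp (zvec (col i B)) (A *m zvec (col j B)) >= 0 :> R) \/
      (dotp (zvec (col j B)) (A *m zvec (col i B)) >= 0 :> R) &
    e = B *m a /\ forall j, 0 <= a j 0].
Proof.
move=> [_ /nbhs_norm0P[d /= d0 dT] Tacute].
have [t t0 td] : exists2 t : R, 0 < t & `|t *: zvec e| < d.
  exists (d / (`|zvec e : 'cV[R]_m| + 1)).
    by rewrite divr_gt0 // ltr_wpDl.
  rewrite normrZ ger0_norm ?divr_ge0 ?ltW //.
  by rewrite mulrAC ltr_pdivrMr ?ltr_wpDl // ltr_pM2l // ltrDl.
have [S ST pS] := dT _ td.
have [B [zB SE acB]] := Tacute S ST.
have uB : B \in unitmx by apply/is_zbasisP.
pose v (i : 'I_m.+1) : 'cV[R]_m :=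
  if unlift ord0 i is Some j then zvec (col j B) else 0.
have Sv u : u \in S -> exists i, u = v i.
  rewrite SE in_fset1U => /orP[/eqP ->|/imfsetP[j _ ->]].
    by exists ord0; rewrite /v unlift_none.
  by exists (lift ord0 j); rewrite /v liftK.
have [w [w0 _]] := hull_elim Sv pS.
rewrite big_ord_recl {1}/v unlift_none scaler0 add0r => teE.
exists S, B, (invmx B *m e); split=> //.
- by move=> j; rewrite SE in_fset1U (in_imfset _ (fun j => zvec (col j B))) ?orbT.
- move=> i j; rewrite neq_ltn => /orP[] ij; [left|right]; exact: acB.
rewrite mulKVmx //; split=> // j.
rewrite -(ler0z R) -(pmulr_rge0 _ t0).
have -> : ((invmx B *m e) j 0)%:~R = (zvec (invmx B *m e) j 0 : R).
  by rewrite [RHS]mxE.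
have -> : t * zvec (invmx B *m e) j 0 = (t *: zvec (invmx B *m e) : 'cV[R]_m) j 0.
  by rewrite [RHS]mxE.
have -> : t *: zvec (invmx B *m e) = \col_j w (lift ord0 j) :> 'cV[R]_m.
  rewrite zvec_mul scalemxAr teE.
  have -> : \sum_(i < m) w (lift ord0 i) *: v (lift ord0 i)
          = map_mx intr B *m \col_j w (lift ord0 j).
    apply/colP => i; rewrite !mxE summxE; apply: eq_bigr => k _.
    by rewrite /v liftK !mxE mulrC.
  by rewrite mulmxA -map_mxM /= mulVmx // map_mx1 mul1mx.
by rewrite mxE.
Qed.

(** Let [e] be a shortest lattice vector for [A] among those on which the
    linear form [l] does not vanish, and [A'] a small perturbation of [A].
    Decompose [e] over the vertices of a simplex of an [A']-acute mesh.  Some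
    vertex [v] in this decomposition satisfies [l v != 0], so it is not
    shorter than [e] for [A].  If [e != v] then acuteness bounds the form
    of [e] below by that of [v] plus that of the nonzero lattice vector
    [e - v], so [v] is shorter than [e] for [A'] by a definite amount. *)
Lemma acute_mesh_vertex (A A' : 'M[R]_m) T (l : 'rV[int]_m) (e : 'cV[int]_m) a eps :
  is_acute_mesh A' T -> is_spd A' -> 0 < a -> 0 <= eps ->
  (forall u, a * dotp u u <= qform A' u) ->
  (forall u, `|qform A u - qform A' u| <= eps * dotp u u) ->
  (l *m e) 0 0 != 0 ->
  (forall z, (l *m z) 0 0 != 0 -> qform A (zvec e) <= qform A (zvec z)) ->
  eps * (dotp (zvec e) (zvec e) + qform A' (zvec e) / a) < a ->
  is_vertex T (zvec e : 'cV[R]_m).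
Proof.
move=> acT spdA' a0 eps0 coer near le0 lmin small.
have [sA' _] := spdA'.
have [S [B [al [ST zB BS acB [eE al0]]]]] := acute_mesh_cone e acT.
have [j lj alj] : exists2 j, (l *m col j B) 0 0 != 0 & al j 0 != 0.
  apply: contrapT => h; move/negP: le0; apply.
  rewrite eE mulmxA mxE big1 // => j _.
  have [alj|alj] := eqVneq (al j 0) 0; first by rewrite alj mulr0.
  have [lj|lj] := eqVneq ((l *m col j B) 0 0) 0; last by case: h; exists j.
  by move: lj; rewrite colE mulmxA -colE mxE => ->; rewrite mul0r.
have [we|w0] := eqVneq (e - col j B) 0.
  by exists S => //; move/eqP: we; rewrite subr_eq0 => /eqP ->.
set v := col j B in lj w0; set w := e - v in w0.
have alj1 : 0 <= al j 0 - 1 by rewrite subr_ge0 -gtz0_ge1 lt_neqAle eq_sym alj al0.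
have vw : 0 <= dotp (zvec v) (A' *m zvec w) :> R.
  have -> : w = B *m (al - delta_mx j 0).
    by rewrite mulmxBr -eE -colE.
  rewrite zvec_mul.
  have -> : map_mx intr B *m zvec (al - delta_mx j 0)
      = \sum_i (al i 0 - (i == j)%:R)%:~R *: zvec (col i B) :> 'cV[R]_m.
    apply/colP => p; rewrite !mxE summxE; apply: eq_bigr => q _.
    by rewrite !mxE mulrC eqxx andbT.
  rewrite mulmx_sumr dotp_sumr sumr_ge0 // => i _.
  rewrite -scalemxAr dotpZr; have [->|ij] := eqVneq i j.
    by rewrite mulr_ge0 ?ler0z // spd_qform_ge0.
  rewrite subr0 mulr_ge0 ?ler0z //.
  by case: (acB i j ij) => //; rewrite dotp_sym.
have eD : qform A' (zvec e) = qform A' (zvec v) + qform A' (zvec w)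
    + 2 * dotp (zvec v) (A' *m zvec w).
  by rewrite -qformD // -zvecD /w subrKC.
have qw : a <= qform A' (zvec w).
  apply: le_trans (coer _); rewrite ler_peMr ?(ltW a0) //.
  exact: one_le_dotp_zvec.
have le1 := lmin v lj.
have := near (zvec v); rewrite ler_norml => /andP[_ nv].
have := near (zvec e); rewrite ler_norml => /andP[ne _].
have dv : dotp (zvec v) (zvec v) <= qform A' (zvec e) / a.
  rewrite ler_pdivlMr // mulrC (le_trans (coer _)) //.
  rewrite eD -addrA lerDl addr_ge0 ?mulr_ge0 //.
  by rewrite (le_trans _ qw) // ltW.
have epsv := ler_wpM2l eps0 dv.
rewrite mulrDr in small.
lra.
Qed.

(** A single constant [C] bounds all the operator norms of [M z] and of its
    inverse.  The reduced basis at [x] then has squared Euclidean length at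
    most [m * C ^ 2], and [eps] is the perturbation of the form that
    [acute_mesh_vertex] tolerates for vectors of this length. *)
Lemma acute_family_stability (Omega : set 'cV[R]_m) (M : 'cV[R]_m -> 'M[R]_m)
    (T : 'cV[R]_m -> {fset {fset 'cV[R]_m}}) :
  (m <= 4)%N -> bounded_set Omega -> {within closure Omega, continuous M} ->
  (forall z, closure Omega z -> is_spd (M z)) ->
  (forall x, Omega x -> is_acute_mesh (M x) (T x)) ->
  exists2 r : R, 0 < r & stability Omega T r.
Proof.
move=> m4 bO cM spdM acT.
have cK := compact_closure_bounded bO.
have subK x : Omega x -> closure Omega x by exact: subset_closure.
have [C0 C0P] := compact_spd_opnorm_bounded cK cM spdM.
pose C := Num.max C0 1.
have C1 : 0 < C by rewrite lt_max ltr01 orbT.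
have CM x : Omega x -> opnorm (M x) <= C.
  by move=> /subK/C0P[h _]; rewrite le_max h.
have CV x : Omega x -> opnorm (invmx (M x)) <= C.
  by move=> /subK/C0P[_ h]; rewrite le_max h.
have coer x u : Omega x -> C^-1 * dotp u u <= qform (M x) u.
  move=> Ox; rewrite mulrC ler_pdivrMr // mulrC.
  apply: le_trans (dotp_le_opnorm_invmx u (spdM x (subK x Ox))) _.
  by rewrite ler_wpM2r ?CV // spd_qform_ge0 //; exact/spdM/subK.
have upper x u : Omega x -> qform (M x) u <= C * dotp u u.
  by move=> Ox; rewrite (le_trans (qform_le_opnorm _ _)) // ler_wpM2r ?dotp_ge0 ?CM.
pose D := m%:R * C ^+ 2 + C ^+ 2 * (m%:R * C ^+ 2).
have D0 : 0 <= D by rewrite addr_ge0 // !mulr_ge0 // ?exprn_ge0 // ltW.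
pose eps := C^-1 / (D + 1).
have eps0 : 0 < eps by rewrite divr_gt0 ?invr_gt0 // ltr_wpDl.
have [r r0 rP] := compact_uniformly_continuous cK cM
  (divr_gt0 eps0 (ltr_wpDl (ler0n R m) (ltr01 : 0 < 1 :> R))).
exists r => // x Ox.
have [B [zB leB redB]] := exists_reduced_zbasis (spdM x (subK x Ox)) m4.
exists B => // y Oy xy j.
have uB : B \in unitmx by apply/is_zbasisP.
pose l := row j (invmx B).
have lE z : (l *m z) 0 0 = (invmx B *m z) j 0 by rewrite -row_mul mxE.
have Mxy u : `|qform (M x) u - qform (M y) u| <= eps * dotp u u.
  have -> : qform (M x) u - qform (M y) u = qform (M x - M y) u.
    by rewrite /qform mulmxBl dotpDr dotpNr.
  apply: le_trans (qform_le_norm _ _) _; rewrite ler_wpM2r ?dotp_ge0 //.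
  have xy' : `|x - y| < r by rewrite (le_lt_trans (norm_le_enorm _)).
  have := ltW (rP x y (subK x Ox) (subK y Oy) xy').
  rewrite ler_pdivlMr ?ltr_wpDl // => h; apply: le_trans h.
  by rewrite mulrC ler_wpM2l // lerDl.
have le_E : energy (M x) 1%:M <= m%:R * C.
  rewrite /energy; apply: (@le_trans _ _ (\sum_(k < m) C)); last first.
    by rewrite sumr_const card_ord mulr_natl.
  apply: ler_sum => k _; apply: le_trans (upper x _ Ox) _.
  have -> : zvec (col k 1%:M) = delta_mx k 0 :> 'cV[R]_m.
    by rewrite colE mul1mx -[zvec _]/(map_mx _ _) map_delta_mx.
  rewrite dotpE (bigD1 k) //= big1 => [|i /negbTE ik]; last by rewrite mxE ik mul0r.
  by rewrite mxE !eqxx mulr1 addr0 mulr1.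
have le_e : dotp (zvec (col j B)) (zvec (col j B)) <= m%:R * C ^+ 2 :> R.
  have := le_trans (coer x (zvec (col j B)) Ox) (le_trans (leB j) le_E).
  by rewrite ler_pdivrMl // mulrCA -expr2.
have small : eps * (dotp (zvec (col j B)) (zvec (col j B))
    + qform (M y) (zvec (col j B)) / C^-1) < C^-1.
  apply: (@le_lt_trans _ _ (eps * D)); last first.
    by rewrite /eps mulrAC ltr_pdivrMr ?ltr_wpDl // ltr_pM2l ?invr_gt0 // ltrDl.
  rewrite ler_wpM2l ?(ltW eps0) // lerD // invrK mulrC expr2 -mulrA.
  rewrite ler_wpM2l ?(ltW C1) //.
  by rewrite (le_trans (upper y _ Oy)) // ler_wpM2l ?(ltW C1).
have lB : (l *m col j B) 0 0 = 1.
  by rewrite lE colE mulmxA mulVmx // mul1mx mxE !eqxx.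
have spdy := spdM y (subK y Oy).
have C0' : 0 < C^-1 by rewrite invr_gt0.
split.
  apply: (acute_mesh_vertex (l := l) (acT y Oy) spdy C0' (ltW eps0) _ Mxy _ _
    small) => //.
  - by move=> u; exact: coer.
  - by rewrite lB.
  - by move=> z; rewrite lE => /redB.
rewrite -zvecN.
apply: (acute_mesh_vertex (l := l) (acT y Oy) spdy C0' (ltW eps0) _ Mxy) => //.
- by move=> u; exact: coer.
- by rewrite mulmxN mxE lB.
- by move=> z; rewrite lE zvecN qformN => /redB.
- by rewrite zvecN qformN dotpNl dotpNr opprK.
Qed.

End Stability.

(** * The mesh of a superbase *)

Lemma card_ord_lt n k : (k <= n)%N -> #|[pred i : 'I_n | (i < k)%N]| = k.
Proof.
move=> kn; rewrite -sum1_card /= -(big_ord_widen _ (fun=> 1%N)) //.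
by rewrite sum1_card card_ord.
Qed.

Lemma downward_closed_ord n (D : pred 'I_n) i :
  (forall j k : 'I_n, (j <= k)%N -> D k -> D j) -> D i = (i < #|D|)%N.
Proof.
move=> Ddown; apply/idP/idP => [Di|].
  rewrite -(card_ord_lt (ltn_ord i)); apply: subset_leq_card.
  apply/fintype.subsetP => j; by rewrite !inE ltnS => /Ddown; apply.
apply: contraTT => nDi; rewrite -leqNgt -[leqRHS](card_ord_lt (ltnW (ltn_ord i))).
apply: subset_leq_card; apply/fintype.subsetP => j Dj; rewrite !inE ltnNge.
by apply: contra nDi => /Ddown; apply.
Qed.

Section Superbase.
Context {R : realType} {m : nat} (E : 'M[int]_(m, m.+1)) (spE : is_superbase E).
Implicit Types (s t : 'S_m.+1).

Local Notation e j := (zvec (col j E) : 'cV[R]_m).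

(** The columns of [F] are linearly dependent; among the coordinates of [p] with
    respect to them, these are the ones that vanish at [ord0]. *)
Definition coords_ord0 (S : comUnitRingType) (F : 'M[S]_(m, m.+1)) (p : 'cV[S]_m)
    (i : 'I_m.+1) : S :=
  if unlift ord0 i is Some j then (invmx (col' ord0 F) *m p) j 0 else 0.

Lemma sum_coords_ord0 (S : comUnitRingType) (F : 'M[S]_(m, m.+1)) p :
  col' ord0 F \in unitmx -> \sum_i coords_ord0 F p i *: col i F = p.
Proof.
move=> uF; rewrite big_ord_recl {1}/coords_ord0 unlift_none scale0r add0r.
rewrite -[RHS](mulKVmx uF); apply/colP => i.
rewrite mxE summxE; apply: eq_bigr => j _.
by rewrite /coords_ord0 liftK !mxE mulrC.
Qed.

Lemma superbase_unitmx : col' ord0 E \in unitmx.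
Proof. by apply/is_zbasisP; case: spE. Qed.

Lemma superbase_unitmx_real : col' ord0 (map_mx intr E) \in (unitmx : {pred 'M[R]_m}).
Proof.
by rewrite -map_col' unitmxE det_map_mx rmorph_unit // -unitmxE superbase_unitmx.
Qed.

Lemma superbase_sum0 : \sum_i e i = 0.
Proof.
by case: spE => s0 _; rewrite -zvec_sum s0 zvec0.
Qed.

Lemma superbase_coords_real (p : 'cV[R]_m) :
  \sum_i coords_ord0 (map_mx intr E) p i *: e i = p.
Proof.
rewrite -[RHS](sum_coords_ord0 p superbase_unitmx_real).
by apply: eq_bigr => i _; rewrite -map_col.
Qed.

Lemma superbase_relation (x : 'I_m.+1 -> R) :
  \sum_i x i *: e i = 0 -> forall i, x i = x ord0.
Proof.
move=> x0 i; have : \sum_j (x j - x ord0) *: e j = 0.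
  under eq_bigr do rewrite scalerBl.
  by rewrite sumrB x0 -scaler_sumr superbase_sum0 scaler0 subrr.
rewrite big_ord_recl subrr scale0r add0r => xl0.
have : map_mx intr (col' ord0 E) *m \col_j (x (lift ord0 j) - x ord0) = 0 :> 'cV[R]_m.
  rewrite -xl0; apply/colP => k; rewrite mxE summxE; apply: eq_bigr => j _.
  by rewrite !mxE mulrC.
have uR : map_mx intr (col' ord0 E) \in (unitmx : {pred 'M[R]_m}).
  by rewrite unitmxE det_map_mx rmorph_unit // -unitmxE superbase_unitmx.
move=> /(congr1 (mulmx (invmx (map_mx intr (col' ord0 E))))).
rewrite mulKmx // mulmx0 => /colP h.
case: (unliftP ord0 i) => [j ->|-> //].
by have := h j; rewrite !mxE => /eqP; rewrite subr_eq0 => /eqP.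
Qed.

(** The index is a natural number, so as to allow [k = m.+1], where the sum over
    the whole superbase vanishes as it does for [k = 0]. *)
Definition partial_sum s (k : nat) : 'cV[int]_m :=
  \sum_(i < m.+1 | (i < k)%N) col (s i) E.

Lemma fmlbr_vertexE s k : fmlbr_vertex E s k = \sum_(j | ((s^-1)%g j < k)%N) e j.
Proof.
rewrite /fmlbr_vertex zvec_sum.
rewrite [RHS](reindex_inj (@perm_inj _ s)) /=.
by apply: eq_bigl => i; rewrite permK.
Qed.

Lemma partial_sum0 s : partial_sum s 0 = 0.
Proof. by rewrite /partial_sum big_pred0. Qed.

Lemma partial_sum_full s : partial_sum s m.+1 = 0.
Proof.
rewrite /partial_sum (eq_bigl predT) => [|i]; last by rewrite ltn_ord.
by case: spE => sE _; rewrite -[RHS]sE [RHS](reindex_inj (@perm_inj _ s)).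
Qed.

Lemma partial_sumS s (k : 'I_m.+1) :
  partial_sum s k.+1 = partial_sum s k + col (s k) E.
Proof.
rewrite /partial_sum (bigD1 k) //= addrC; congr (_ + _).
by apply: eq_bigl => i; rewrite ltnS [RHS]ltn_neqAle andbC.
Qed.

Definition fmlbr_basis s : 'M[int]_m := \matrix_(i, k) partial_sum s k.+1 i 0.

Lemma col_fmlbr_basis s k : col k (fmlbr_basis s) = partial_sum s k.+1.
Proof. by apply/colP => i; rewrite !mxE. Qed.

(** Each member of the superbase is a difference of consecutive partial sums. *)
Lemma fmlbr_basis_zbasis s : is_zbasis (fmlbr_basis s).
Proof.
(* coordinates of the partial sums: zero at both ends [0] and [m.+1] *)
pose D k : 'cV[int]_m := \col_i (i.+1 == k)%:R.
have DE k : (k <= m.+1)%N -> partial_sum s k = fmlbr_basis s *m D k.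
  case: k => [|k] km.
    rewrite partial_sum0 (_ : D 0%N = 0) ?mulmx0 //.
    by apply/colP => i; rewrite !mxE.
  move: km; rewrite ltnS leq_eqVlt => /orP[/eqP ->|km].
    rewrite partial_sum_full (_ : D m.+1 = 0) ?mulmx0 //.
    by apply/colP => i; rewrite !mxE eqSS ltn_eqF.
  rewrite -(col_fmlbr_basis s (Ordinal km)) colE; congr (_ *m _).
  by apply/colP => i; rewrite !mxE eqSS andbT.
pose l j := (s^-1)%g (lift ord0 j).
have EB : col' ord0 E = fmlbr_basis s *m \matrix_(i, j) (D (l j).+1 - D (l j)) i 0.
  apply/matrixP => i j.
  have : col (lift ord0 j) E = fmlbr_basis s *m (D (l j).+1 - D (l j)).
    rewrite mulmxBr -!DE ?ltn_ord ?(ltnW (ltn_ord _)) // partial_sumS permKV.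
    by rewrite addrAC subrr add0r.
  move=> /colP/(_ i); rewrite !mxE => ->; apply: eq_bigr => k _.
  by rewrite !mxE.
apply/is_zbasisP; have := superbase_unitmx.
by rewrite EB !unitmxE det_mulmx unitrM => /andP[].
Qed.

Lemma fmlbr_vertex0 s : fmlbr_vertex E s ord0 = 0 :> 'cV[R]_m.
Proof. by rewrite /fmlbr_vertex big_pred0 // zvec0. Qed.

Lemma fmlbr_vertex_lift s j :
  fmlbr_vertex E s (lift ord0 j) = zvec (col j (fmlbr_basis s)) :> 'cV[R]_m.
Proof. by rewrite col_fmlbr_basis. Qed.

Lemma fmlbr_simplexE s :
  fmlbr_simplex E s = (0 |` [fset zvec (col j (fmlbr_basis s)) | j in 'I_m])%fset
  :> {fset 'cV[R]_m}.
Proof.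
apply/fsetP => u; rewrite in_fset1U; apply/imfsetP/orP => /= [[k _ ->]|[/eqP ->|]].
- case: (unliftP ord0 k) => [j ->|->]; [right|left].
    by rewrite fmlbr_vertex_lift; apply/imfsetP; exists j.
  by rewrite fmlbr_vertex0.
- by exists ord0; rewrite // fmlbr_vertex0.
- move=> /imfsetP[j _ ->]; exists (lift ord0 j) => //.
  by rewrite fmlbr_vertex_lift.
Qed.

Lemma fmlbr_simplex_nonflat s : is_simplex (fmlbr_simplex E s : {fset 'cV[R]_m}).
Proof.
exists (fmlbr_vertex E s) => //.
have -> : \matrix_(i < m, j < m)
    (fmlbr_vertex E s (lift ord0 j) - fmlbr_vertex E s ord0) i 0
    = map_mx intr (fmlbr_basis s) :> 'M[R]_m.
  apply/matrixP => i j; rewrite mxE fmlbr_vertex0 fmlbr_vertex_lift subr0.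
  by rewrite !mxE.
rewrite det_map_mx intr_eq0.
by case: (fmlbr_basis_zbasis s) => ->.
Qed.

Lemma sum_fmlbr_vertex s (w : 'I_m.+1 -> R) :
  \sum_k w k *: fmlbr_vertex E s k
  = \sum_j (\sum_(k : 'I_m.+1 | ((s^-1)%g j < k)%N) w k) *: e j.
Proof.
under eq_bigr do rewrite fmlbr_vertexE scaler_sumr.
rewrite (exchange_big_dep predT) //=; apply: eq_bigr => j _.
by rewrite scaler_suml.
Qed.

(** A point [\sum_j x j *: e j] of the simplex of [s] has its coordinates [x]
    in nonincreasing order along [s], the last one being zero, which makes [x]
    unique; the barycentric coordinates are the gaps.  So the vertices that
    carry weight correspond to superlevel sets of [x], which do not depend on
    the simplex. *)
Lemma fmlbr_conforming s t :
  hull (fmlbr_simplex E s : {fset 'cV[R]_m}) `&` hull (fmlbr_simplex E t)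
  = hull (fmlbr_simplex E s `&` fmlbr_simplex E t)%fset.
Proof.
apply/seteqP; split; last first.
  by move=> p pI; split; move: p pI; apply: hull_subset;
    [exact: fsubsetIl|exact: fsubsetIr].
move=> p [ps pt].
have Vin s' (u : 'cV[R]_m) :
    u \in fmlbr_simplex E s' -> exists k, u = fmlbr_vertex E s' k.
  by move=> /imfsetP[k _ ->]; exists k.
have [w [w0 w1 pw]] := hull_elim (Vin s) ps.
have [w' [w'0 w'1 pw']] := hull_elim (Vin t) pt.
pose x j := \sum_(k : 'I_m.+1 | ((s^-1)%g j < k)%N) w k.
pose y j := \sum_(k : 'I_m.+1 | ((t^-1)%g j < k)%N) w' k.
have xy : x =1 y.
  (* equal up to a constant, which vanishes since both have minimum zero *)
  have rel : forall j, x j - y j = x ord0 - y ord0.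
    apply: (superbase_relation (x := fun j => x j - y j)).
    under eq_bigr do rewrite scalerBl.
    by rewrite sumrB -!sum_fmlbr_vertex -pw -pw' subrr.
  have last0 (s' : 'S_m.+1) (v : 'I_m.+1 -> R) :
      \sum_(k : 'I_m.+1 | ((s'^-1)%g (s' ord_max) < k)%N) v k = 0.
    by rewrite permK big_pred0 // => k; rewrite ltnNge -ltnS ltn_ord.
  have xs : x (s ord_max) = 0 by exact: last0.
  have yt : y (t ord_max) = 0 by exact: last0.
  have x0 j : 0 <= x j by rewrite sumr_ge0.
  have y0 j : 0 <= y j by rewrite sumr_ge0.
  have c1 := rel (s ord_max); rewrite xs sub0r in c1.
  have c2 := rel (t ord_max); rewrite yt subr0 in c2.
  have c0 : x ord0 - y ord0 = 0.
    by apply/eqP; rewrite eq_le -{1}c1 oppr_le0 y0 -c2 x0.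
  by move=> j; apply/eqP; rewrite -subr_eq0 rel c0.
rewrite pw; apply: hull_intro => // k wk.
rewrite in_fsetI; apply/andP; split; first exact: in_imfset.
have -> : fmlbr_vertex E s k = fmlbr_vertex E t k :> 'cV[R]_m; last exact: in_imfset.
pose theta := \sum_(l : 'I_m.+1 | (k <= l)%N) w l.
(* the first [k] members along [s] form the superlevel set {x >= theta}, and
   counting shows below that so do the first [k] members along [t] *)
have sx j : ((s^-1)%g j < k)%N = (theta <= x j).
  apply/idP/idP => [jk|].
    rewrite /theta /x [leLHS]big_mkcond [leRHS]big_mkcond ler_sum // => l _.
    case: ifP => [kl|_]; first by rewrite (leq_trans jk kl).
    by case: ifP.
  apply: contraTT; rewrite -leqNgt -ltNge => kj.
  rewrite /theta (bigD1 k) //= -subr_gt0.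
  apply: (@lt_le_trans _ _ (w k)); first by rewrite lt_neqAle eq_sym wk w0.
  rewrite -addrA lerDl subr_ge0 /x [leLHS]big_mkcond [leRHS]big_mkcond.
  apply: ler_sum => l _; case: ifP => [jl|_]; last by case: ifP.
  have kl := leq_ltn_trans kj jl.
  by rewrite (ltnW kl) -(inj_eq val_inj) /= gtn_eqF.
pose D := [pred i | theta <= x (t i)].
have Ddown (i j : 'I_m.+1) : (i <= j)%N -> D j -> D i.
  rewrite /= => ij /le_trans; apply; rewrite !xy /y !permK.
  rewrite [leLHS]big_mkcond [leRHS]big_mkcond ler_sum // => l _.
  case: ifP => [jl|_]; first by rewrite (leq_ltn_trans ij jl).
  by case: ifP.
have Dk : #|D| = k.
  rewrite -[RHS](card_ord_lt (ltnW (ltn_ord k))) -!sum1_card.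
  rewrite (reindex_inj (@perm_inj _ (t^-1)%g)) /=.
  rewrite [RHS](reindex_inj (@perm_inj _ (s^-1)%g)) /=.
  by apply: eq_bigl => j; rewrite !inE /= permKV sx.
rewrite !fmlbr_vertexE; apply: eq_bigl => j.
by rewrite sx -{1}Dk -(downward_closed_ord _ Ddown) /= permKV.
Qed.

(** Order the coordinates decreasingly to find the simplex containing a given
    point near the origin. *)
Lemma fmlbr_covers : covers_nbhs0 (fmlbr_mesh E : {fset {fset 'cV[R]_m}}).
Proof.
pose C : 'M[R]_m := invmx (col' ord0 (map_mx intr E)).
have n0 : 0 < m%:R * `|C| + 1 by rewrite ltr_wpDl // mulr_ge0.
apply: (iffRL (@nbhs_norm0P _ _ (\bigcup_(S in [set` fmlbr_mesh E]) hull S))).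
(* the coordinates of such points are at most 1/2, so they differ by at most 1 *)
exists (2^-1 / (m%:R * `|C| + 1)) => /=.
  by rewrite divr_gt0.
move=> p /= psmall.
pose x := coords_ord0 (map_mx intr E) p.
have x_le i : `|x i| <= 2^-1.
  rewrite /x /coords_ord0; case: unliftP => [j _|_]; last first.
    by rewrite normr0 invr_ge0.
  rewrite mxE (le_trans (ler_norm_sum _ _ _)) //.
  apply: (@le_trans _ _ (\sum_(k < m) `|C| * `|p|)).
    by apply: ler_sum => k _; rewrite normrM ler_pM // mx_entry_le_norm.
  rewrite sumr_const card_ord -[_ *+ m]mulr_natl mulrA.
  move: psmall; rewrite ltr_pdivlMr // => /ltW h; apply: le_trans h.
  by rewrite mulrC ler_wpM2l // lerDl.
pose leT := [rel i j | x j <= x i].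
have leT_total : total leT by move=> i j; rewrite /= le_total.
have leT_trans : transitive leT by move=> j i k /= ij jk; exact: le_trans jk ij.
pose sx := sort leT (ord_tuple m.+1).
have [s sE] : exists s : 'S_m.+1, sx = [tuple tnth (ord_tuple m.+1) (s i) | i < m.+1].
  by apply/tuple_permP; rewrite perm_sort.
have s_anti (i j : 'I_m.+1) : (i <= j)%N -> x (s j) <= x (s i).
  move=> ij.
  have sk (k : 'I_m.+1) : nth ord0 sx k = s k.
    by rewrite sE -tnth_nth tnth_mktuple tnth_ord_tuple.
  rewrite -!sk.
  apply: (sorted_leq_nth leT_trans _ ord0 (sort_sorted leT_total _)) => //.
  - by move=> k /=.
  - by rewrite inE size_sort size_tuple.
  - by rewrite inE size_sort size_tuple.
pose a (i : nat) := x (s (inord i)).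
(* barycentric coordinates: the gaps of [x] along [s], the origin taking the rest *)
pose w (k : nat) := if k is k'.+1 then a k' - a k else 1 - (a 0%N - a m).
have a_anti i j : (i <= j)%N -> (j <= m)%N -> a j <= a i.
  move=> ij jm; apply: s_anti; rewrite !inordK //.
  exact: leq_ltn_trans ij _.
have w_tail i : (i <= m)%N -> \sum_(k < m.+1 | (i < k)%N) w k = a i - a m.
  move=> im; rewrite -(big_geq_mkord i.+1 m.+1 xpredT w) big_add1 /=.
  rewrite (telescope_sumr_eq (fun k => - a k)) //; first by rewrite opprK addrC.
  by move=> k _; rewrite /= opprK addrC.
exists (fmlbr_simplex E s); first exact: in_imfset.
have -> : p = \sum_(k < m.+1) w k *: fmlbr_vertex E s k.
  rewrite (sum_fmlbr_vertex s (fun k : 'I_m.+1 => w k)) -[LHS]superbase_coords_real -/x.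
  have -> : \sum_i x i *: e i = \sum_i (x i - a m) *: e i.
    under [RHS]eq_bigr do rewrite scalerBl.
    by rewrite sumrB -scaler_sumr superbase_sum0 scaler0 subr0.
  apply: eq_bigr => j _; rewrite w_tail; last by rewrite -ltnS ltn_ord.
  by rewrite /a inord_val permKV.
apply: hull_intro => [k||k _].
- case: k => [[|k] km] /=; last by rewrite subr_ge0 a_anti.
  rewrite subr_ge0.
  have := x_le (s (inord 0)); have := x_le (s (inord m)).
  rewrite !ler_norml -/(a 0%N) -/(a m) => /andP[h1 _] /andP[_ h2].
  rewrite (le_trans (lerB h2 h1)) // opprK; lra.
- rewrite (bigD1 ord0) //= (eq_bigl (fun k : 'I_m.+1 => (0 < k)%N)).
    by rewrite w_tail // subrK.
  by move=> k; rewrite lt0n.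
- exact: in_imfset.
Qed.

End Superbase.

(** * Obtuse superbases *)

Section FMLBR.
Context {R : realType} {m : nat} (A : 'M[R]_m) (E : 'M[int]_(m, m.+1)).
Context (spdA : is_spd A) (spE : is_superbase E) (obE : is_obtuse A E).
Implicit Types (s : 'S_m.+1).

Local Notation e j := (zvec (col j E) : 'cV[R]_m).

Lemma obtuse_le0 i j : i != j -> dotp (e i) (A *m e j) <= 0.
Proof.
rewrite neq_ltn => /orP[] ij; first exact: obE.
by case: spdA => sA _; rewrite dotp_sym //; exact: obE.
Qed.

(** The second vector is minus the sum of the complementary members of the
    superbase, none of which occurs in the first one. *)
Lemma fmlbr_vertex_acute s (k l : 'I_m.+1) : (k <= l)%N ->
  0 <= dotp (fmlbr_vertex E s k) (A *m fmlbr_vertex E s l).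
Proof.
move=> kl; rewrite !fmlbr_vertexE.
have -> : \sum_(j | ((s^-1)%g j < l)%N) e j = - \sum_(j | ~~ ((s^-1)%g j < l)%N) e j.
  apply/eqP; rewrite -addr_eq0; apply/eqP.
  apply: etrans (superbase_sum0 spE).
  by rewrite [RHS](bigID (fun j => ((s^-1)%g j < l)%N)).
rewrite mulmxN dotpNr oppr_ge0 mulmx_sumr dotp_sumr sumr_le0 // => j lj.
rewrite dotp_suml sumr_le0 // => i ik; apply: obtuse_le0.
by apply: contraNneq lj => <-; exact: leq_trans ik kl.
Qed.

Lemma fmlbr_acute_mesh : is_acute_mesh A (fmlbr_mesh E : {fset {fset 'cV[R]_m}}).
Proof.
split; [split| exact: fmlbr_covers |].
- by move=> S /imfsetP[s _ ->]; exact: fmlbr_simplex_nonflat.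
- by move=> S S' /imfsetP[s _ ->] /imfsetP[t _ ->]; exact: fmlbr_conforming.
- move=> S /imfsetP[s _ ->]; exists (fmlbr_basis E s); split.
  + exact: fmlbr_basis_zbasis.
  + exact: fmlbr_simplexE.
  + move=> i j ij; rewrite -!fmlbr_vertex_lift.
    by apply: fmlbr_vertex_acute => //; rewrite leq_bump2 ltnW.
Qed.

(** Expand the squares: since the superbase sums to zero, so do the rows of its
    Gram matrix, and only the cross terms [x i * x j] survive. *)
Lemma selling_formula (x : 'I_m.+1 -> R) :
  qform A (\sum_j x j *: e j)
  = - (\sum_i \sum_j dotp (e i) (A *m e j) * (x i - x j) ^+ 2) / 2.
Proof.
have sA : A^T = A by case: spdA.
have g0 i : \sum_j dotp (e i) (A *m e j) = 0.
  by rewrite -dotp_sumr -mulmx_sumr (superbase_sum0 spE) mulmx0 dotp0r.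
pose g i j := dotp (e i) (A *m e j).
have -> : \sum_i \sum_j g i j * (x i - x j) ^+ 2
        = - 2 * \sum_i \sum_j g i j * (x i * x j).
  have -> : \sum_i \sum_j g i j * (x i - x j) ^+ 2
      = \sum_i x i ^+ 2 * \sum_j g i j + \sum_j x j ^+ 2 * \sum_i g i j
        - 2 * \sum_i \sum_j g i j * (x i * x j).
    under [X in _ = X + _ - _]eq_bigr do rewrite mulr_sumr.
    under [X in _ = _ + X - _]eq_bigr do rewrite mulr_sumr.
    rewrite [X in _ = _ + X - _]exchange_big /= mulr_sumr -big_split -sumrB /=.
    apply: eq_bigr => i _; rewrite mulr_sumr -big_split -sumrB /=.
    by apply: eq_bigr => j _; ring.
  rewrite [X in X + _ - _]big1 => [|i _]; last by rewrite g0 mulr0.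
  rewrite [X in _ + X - _]big1 => [|j _]; last first.
    by rewrite (eq_bigr (g j)) ?g0 ?mulr0 // => i _; rewrite /g dotp_sym.
  by rewrite !add0r mulNr.
rewrite mulNr opprK mulrAC divff // mul1r.
rewrite /qform mulmx_sumr dotp_suml; apply: eq_bigr => i _.
rewrite dotpZl dotp_sumr mulr_sumr; apply: eq_bigr => j _.
by rewrite -scalemxAr dotpZr /g; ring.
Qed.

(** A partial sum of the superbase is shortest in its class modulo [2]: in its
    Selling expression every squared coefficient difference is 0 or 1, and
    changing the coefficients by even integers cannot decrease any of them. *)
Lemma partial_sum_shortest_mod2 s k (y : 'cV[int]_m) :
  qform A (fmlbr_vertex E s k) <= qform A (fmlbr_vertex E s k - 2 *: zvec y).
Proof.
pose a := coords_ord0 E y.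
pose chi j : int := ((s^-1)%g j < k)%N.
have yE : zvec y = \sum_j (a j)%:~R *: e j :> 'cV[R]_m.
  rewrite -[in LHS](sum_coords_ord0 y (superbase_unitmx spE)) zvec_sum.
  by apply: eq_bigr => j _; rewrite -[LHS]/(map_mx _ _) map_mxZ.
have vE : fmlbr_vertex E s k = \sum_j (chi j)%:~R *: e j.
  rewrite fmlbr_vertexE big_mkcond; apply: eq_bigr => j _.
  by rewrite /chi; case: ifP => _; rewrite ?scale1r ?scale0r.
have -> : fmlbr_vertex E s k - 2 *: zvec y = \sum_j (chi j - 2 * a j)%:~R *: e j.
  rewrite vE yE scaler_sumr -sumrB; apply: eq_bigr => j _.
  by rewrite scalerA -scalerBl intrB intrM.
rewrite vE !selling_formula ler_pM2r ?invr_gt0 // lerN2.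
apply: ler_sum => i _; apply: ler_sum => j _.
have [->|ij] := eqVneq i j; first by rewrite !subrr.
rewrite ler_wnM2l ?obtuse_le0 //.
rewrite -!intrB -!rmorphXn ler_int /=.
rewrite /chi; case: (_ < k)%N; case: (_ < k)%N; move: (a i) (a j) => p q; nia.
Qed.

(** Reduce the coordinates of the vertex modulo [2] to [0] and [1]. *)
Lemma fmlbr_vertex_enorm s k :
  enorm (fmlbr_vertex E s k : 'cV[R]_m) <= Num.sqrt m%:R * kappa A.
Proof.
pose v := \sum_(i < m.+1 | (i < k)%N) col (s i) E.
have vE : fmlbr_vertex E s k = zvec v :> 'cV[R]_m by [].
pose z : 'cV[int]_m := \col_i (v i 0%R %% 2)%Z.
pose y : 'cV[int]_m := \col_i (v i 0%R %/ 2)%Z.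
have zE : fmlbr_vertex E s k - 2 *: zvec y = zvec z :> 'cV[R]_m.
  rewrite vE; apply/colP => i; rewrite !mxE {1}(divz_eq (v i 0) 2).
  by rewrite rmorphD rmorphM /=; ring.
have zz : dotp (zvec z) (zvec z) <= m%:R :> R.
  rewrite dotpE; apply: (@le_trans _ _ (\sum_(i < m) 1)).
    apply: ler_sum => i _; rewrite !mxE -intrM lerz1.
    have := modz_ge0 (v i 0) (isT : 2 != 0 :> int).
    have := ltz_pmod (v i 0) (isT : 0 < 2 :> int).
    by move: (v i 0%R %% 2)%Z => r; nia.
  by rewrite sumr_const card_ord.
rewrite enorm_le ?mulr_ge0 ?sqrtr_ge0 // exprMn sqr_sqrtr //.
rewrite /kappa sqr_sqrtr ?mulr_ge0 ?opnorm_ge0 //.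
apply: le_trans (dotp_le_opnorm_invmx _ spdA) _.
rewrite mulrA [leRHS]mulrC ler_wpM2l ?opnorm_ge0 //.
apply: le_trans (partial_sum_shortest_mod2 s k y) _.
rewrite zE; apply: le_trans (qform_le_opnorm _ _) _.
by rewrite [leRHS]mulrC ler_wpM2l ?opnorm_ge0.
Qed.

End FMLBR.

(** * Stability and boundedness over the domain *)

Lemma kappa_le_max (R : realType) (m : nat) (Omega : set 'cV[R]_m)
    (M : 'cV[R]_m -> 'M[R]_m) x :
  bounded_set Omega -> {within closure Omega, continuous M} ->
  (forall z, closure Omega z -> is_spd (M z)) -> closure Omega x ->
  kappa (M x) <= kappa_max Omega M.
Proof.
move=> bO cM spdM Kx.
have [C CP] := compact_spd_opnorm_bounded (compact_closure_bounded bO) cM spdM.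
apply: ub_le_sup; last by exists x.
exists C => _ [z Kz <-]; have [h1 h2] := CP z Kz.
have C0 : 0 <= C by rewrite (le_trans (opnorm_ge0 (M z))).
rewrite /kappa -(ger0_norm C0) -sqrtr_sqr ler_sqrt ?sqr_ge0 // expr2.
by rewrite ler_pM ?opnorm_ge0.
Qed.

Theorem proposition1p8 (R : realType) (m : nat)
  (Omega : set 'cV[R]_m) (M : 'cV[R]_m -> 'M[R]_m)
  (Omega_open : open Omega) (Omega_bounded : bounded_set Omega)
  (M_cont : {within closure Omega, continuous M})
  (M_spd : forall z, closure Omega z -> is_spd (M z)) :
  ((m <= 3)%N ->
     forall E : 'M[R]_m -> 'M[int]_(m, m.+1),
       (forall A, is_spd A -> is_superbase (E A) /\ is_obtuse A (E A)) ->
       [/\ admissible Omega (fun x => fmlbr_mesh (E (M x))),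
           m = 2%N -> boundedness Omega (fun x => fmlbr_mesh (E (M x)))
                      (2 * kappa_max Omega M) &
           m = 3%N -> boundedness Omega (fun x => fmlbr_mesh (E (M x)))
                      (4 * kappa_max Omega M)])
  /\
  ((m <= 4)%N ->
     forall T : 'cV[R]_m -> {fset {fset 'cV[R]_m}},
       (forall x, Omega x -> is_acute_mesh (M x) (T x)) ->
       exists2 r : R, 0 < r & stability Omega T r).
Proof.
split=> [m3 E EP|m4 T]; last exact: acute_family_stability.
have spdO x : Omega x -> is_spd (M x) by move=> /subset_closure/M_spd.
have acute x : Omega x -> is_acute_mesh (M x) (fmlbr_mesh (E (M x))).
  by move=> Ox; have [] := EP _ (spdO x Ox); apply: fmlbr_acute_mesh; exact: spdO.
have bound c : Num.sqrt m%:R <= c ->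
    boundedness Omega (fun x => fmlbr_mesh (E (M x))) (c * kappa_max Omega M).
  move=> mc x Ox u [S /imfsetP[s _ ->] /imfsetP[k _ ->]].
  have [spE obE] := EP _ (spdO x Ox).
  apply: le_trans (fmlbr_vertex_enorm (spdO x Ox) spE obE s k) _.
  apply: ler_pM; rewrite ?sqrtr_ge0 //.
  by apply: kappa_le_max => //; exact: subset_closure.
have bound_nat c : (m <= c ^ 2)%N ->
    boundedness Omega (fun x => fmlbr_mesh (E (M x))) (c%:R * kappa_max Omega M).
  move=> mc; apply: bound.
  by rewrite -[leRHS]ger0_norm // -sqrtr_sqr ler_sqrt ?sqr_ge0 // -natrX ler_nat.
split=> [|m2|m3']; [|by apply: bound_nat; rewrite m2|by apply: bound_nat; rewrite m3'].
split; first by move=> x /acute[].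
have [r r0 rP] := acute_family_stability (leqW m3) Omega_bounded M_cont M_spd acute.
exists r, (Num.sqrt m%:R * kappa_max Omega M); split=> //.
- move=> x Ox; split; first by case: (acute x Ox).
  by move=> u [S /imfsetP[s _ ->] /imfsetP[k _ ->]]; eexists.
- exact: bound.
Qed.
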